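(* Let $q\geq 2$ be a prime power and let $n\geq 1$. Let $\omega(\mathrm{GL}_n(q))$ be the maximum cardinality of a pairwise non-commuting subset of $\mathrm{GL}_n(q)$ and let $l(q)=\prod_{k=1}^\infty(1-q^{-k})^{-k(k+1)/2-1}$. Then $$q^{-n}\left(1-q^{-3}-q^{-5}+q^{-6}-q^{-n}\right)\leq\frac{\omega(\mathrm{GL}_n(q))}{|\mathrm{GL}_n(q)|}\leq q^{-n}\,l(q),$$ and moreover $l(q)\leq 1+2q^{-1}+7q^{-2}+114q^{-3}$ if $q\geq 3$, and $l(q)\leq 395.0005$ if $q=2$.
   Context: $\mathrm{GL}_n(q)$ is the group of invertible $n\times n$ matrices over the field with $q$ elements. A subset $X$ of a group is pairwise non-commuting if $xy\neq yx$ for all distinct $x,y\in X$. *)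

(* Defs.v *)
From mathcomp Require Import all_boot all_order all_algebra all_fingroup.
From mathcomp Require Import all_classical all_reals all_analysis.

Set Implicit Arguments.
Unset Strict Implicit.
Unset Printing Implicit Defensive.

Import Order.TTheory GRing.Theory Num.Theory.
Import numFieldNormedType.Exports.

Local Open Scope ring_scope.

Definition prime_power (q : nat) : Prop :=
  exists p k : nat, [/\ prime p, (0 < k)%N & q = (p ^ k)%N].

Definition noncommuting (gT : finGroupType) (X : {set gT}) : bool :=
  [forall x in X, forall y in X, (x != y) ==> (x * y != y * x)%g].

Definition omega (gT : finGroupType) (G : {group gT}) : nat :=
  \max_(X : {set gT} | (X \subset G) && noncommuting X) #|X|.

(* [k * k.+1] is always even, so the halving below is exact. *)
Definition l_partial (R : realType) (q m : nat) : R :=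
  \prod_(1 <= k < m.+1) (1 - q%:R ^- k) ^- ((k * k.+1)./2 + 1).

Definition l (R : realType) (q : nat) : R := limn (l_partial R q).

(* Main.v *)
From HB Require Import structures.
Require Import Defs.
From mathcomp Require Import all_boot all_order all_algebra all_fingroup.
From mathcomp Require Import all_classical all_reals all_analysis.
From mathcomp Require Import all_field ring lra zify.

(** Let [x = 1/q] and let [a_n] be [omega] of [GL_n(q)] divided by the
    order of the group, with [a_0 = 1]. Any set of pairwise non-commuting matrices
    meets the commutative centralizer of a companion matrix in at most one element,
    and every matrix is a direct sum of companion matrices of powers of irreducible
    polynomials.

    Upper bound. Let [X] be a maximal non-commuting set of [n x n] matrices. By
    [primary_decomposition], each member [g] of [X] is a sum of blocks, of types
    [(d, k)] with [sum d k = n]; on a block of type [(d, k)], [g] acts as the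
    companion matrix of [p' ^+ k] with [p'] irreducible of degree [d]. Fix one
    irreducible [p] in each degree [d]. A pair [(A, B)] of matrices whose rows form
    a basis is adapted to [g] if the row space of [B] is [g]-stable and if [A g = z
    A] with [z] commuting with the companion matrix [C] of [p ^+ k]. Each block of
    type [(d, k)] of [g] produces at least [D = block_weight d k] times [#|GL_(n - d
    k)|] adapted pairs ([card_adapted_block]): the residues [f] modulo [p ^+ k] with
    minimal polynomial [p' ^+ k] make [f(C)] similar to the block, and they are
    counted by lifting the [d] roots of [p'] modulo [p] ([card_lift_rV]). On the
    other hand, the members of [X] to which a given pair is adapted commute with
    each other on the rows of [A], hence do not on the rows of [B], so there are at
    most [omega] of [GL_(n - d k)] of them ([card_adapted_fiber]). Counting blocks
    of all members of [X] by dimension gives ([ncdens_recursion]) [n a_n <= sum_(d,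
    k) (d k / D) a_(n - d k)].

    With [Q = q^d], the quotient [Q^k / D] is [1/d] plus a small excess [w] for [k =
    1], and a small excess [w] for [k > 1] ([block_weight_ratio]). The recursion
    therefore compares [q^n a_n] with the coefficients of [(1 - v)^-1 exp (sum w
    v^(d k))] ([expcoef_pointwise]), which are at most [exp (sum w)]. For [y = x^d],
    the excesses of degree [d] sum to [(y / (1 - y) + y / (1 - y)^3) / d], and [y /
    (1 - y) + y / (1 - y)^3] is the sum over [k >= 1] of [(k (k + 1) / 2 + 1) y^k].
    Summed over [d], this is exactly [log l(q)] ([exp_loglimit_le]).

    Lower bound. The companion matrix [C] of a monic polynomial of degree [n] with
    nonzero constant term has a commutative centralizer; with [r] roots of the
    polynomial in the field, that centralizer contains at most [(q - 1)^r q^(n - r)]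
    invertible elements [h(C)], because [h] does not vanish at the roots. A
    non-commuting set that is maximal among conjugates of such matrices meets the
    centralizer of each conjugate, so its size is at least the sum over these
    polynomials of [#|GL_n(q)| / c^2], with [c] the order of the centralizer
    ([ncmax_ge_sum_conj_weight]). Counting the polynomials and their roots yields
    [a_n >= q^-n], which is more than is claimed.

    Numerical bounds. The tail of the product is controlled by [prod (1 - t_k) >= 1
    - sum t_k] and the closed form of [sum_(k > K) (k (k + 1) / 2 + 1) y^k]
    ([eulerprod_tail]). At [x = 1/2], seven factors suffice. As a function of [x],
    every partial product (from the second on) is [1 + 2 x + 7 x^2 + x^3 psi x] with
    [psi] nondecreasing, and [psi] is bounded by its value at [x = 1/3], which is at
    most 114 since the product is there at most [20/3]. *)

Set Implicit Arguments.
Unset Strict Implicit.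
Unset Printing Implicit Defensive.

Import Order.TTheory GRing.Theory Num.Theory.
Import numFieldNormedType.Exports.

Local Open Scope ring_scope.

(** * Krylov matrices and companion matrices *)

Section Krylov.
Variable F : fieldType.

(** The matrix with rows [v], [v x], ..., [v x^(N-1)]. Matrices act on row vectors,
    so its row space lies in the cyclic submodule generated by [v]. *)
Definition krylov N n (x : 'M[F]_n.+1) (v : 'rV[F]_n.+1) : 'M[F]_(N, n.+1) :=
  \matrix_(i < N) (v *m x ^+ i).

(** The [N x N] companion matrix of a monic polynomial [f] of degree [N], acting on
    row vectors: the row [e_i] goes to [e_(i+1)], and the last row carries minus the
    lower coefficients of [f]. It represents multiplication by the variable on
    [F[X]/(f)]. *)
Definition compmx N (f : {poly F}) : 'M[F]_N :=
  \matrix_(i, j) if i.+1 == N then - f`_j else (i.+1 == j)%:R.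

Lemma horner_mxE n (x : 'M[F]_n.+1) m (u : 'rV[F]_m) :
  horner_mx x (rVpoly u) = \sum_(i < m) u 0 i *: x ^+ i.
Proof.
rewrite horner_rVpoly mulmx_sum_row linear_sum; apply: eq_bigr => i _.
by rewrite linearZ /= rowK mxvecK.
Qed.

Lemma mul_krylov N n (x : 'M[F]_n.+1) v (u : 'rV[F]_N) :
  u *m krylov N x v = v *m horner_mx x (rVpoly u).
Proof.
rewrite horner_mxE mulmx_sum_row mulmx_sumr; apply: eq_bigr => i _.
by rewrite rowK scalemxAr.
Qed.

(** An intertwiner of [x] and [y] intertwines all polynomials in them. *)
Lemma horner_mx_intertwine m n (A : 'M[F]_(m.+1, n.+1)) x y g :
  A *m x = y *m A -> A *m horner_mx x g = horner_mx y g *m A.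
Proof.
move=> Axy; elim/poly_ind: g => [|g c IH]; first by rewrite !rmorph0 mulmx0 mul0mx.
rewrite !rmorphD !rmorphM /= !horner_mx_X !horner_mx_C.
by rewrite mulmxDr mulmxDl mulmxA IH -mulmxA Axy mulmxA scalar_mxC.
Qed.

Lemma monic_rVpoly N (f : {poly F}) : f \is monic -> size f = N.+1 ->
  f = 'X^N + rVpoly (\row_(i < N) f`_i).
Proof.
move=> mf sf; apply/polyP => i; rewrite coefD coefXn coef_rVpoly.
case: insubP => [j _ <-|]; first by rewrite mxE (ltn_eqF (ltn_ord j)) add0r.
rewrite -leqNgt addr0 leq_eqVlt eq_sym => /orP[/eqP-> | ltNi].
  by rewrite eqxx; move: mf; rewrite monicE lead_coefE sf => /eqP.
by rewrite (gtn_eqF ltNi) nth_default ?sf.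
Qed.

(** If [f] annihilates [v], then [x] acts on the Krylov rows of [v] as the companion
    matrix of [f]. *)
Lemma krylov_compmx N n (x : 'M[F]_n.+1) v f :
    f \is monic -> size f = N.+1 -> v *m horner_mx x f = 0 ->
  krylov N x v *m x = compmx N f *m krylov N x v.
Proof.
move=> mf sf vf0; apply/row_matrixP => i; rewrite !row_mul rowK -mulmxA.
rewrite mulmxE -exprSr [RHS]mulmx_sum_row.
have [eN | neN] := eqVneq i.+1 N.
  have {vf0} vxN : v *m x ^+ N = - (v *m horner_mx x (rVpoly (\row_(i < N) f`_i))).
    apply/eqP; rewrite -addr_eq0 -mulmxDr -{1}(horner_mx_X x) -rmorphXn -rmorphD.
    by rewrite -(monic_rVpoly mf sf) vf0.
  rewrite eN vxN horner_mxE mulmx_sumr -sumrN; apply: eq_bigr => j _.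
  by rewrite rowK !mxE eN eqxx scaleNr scalemxAr.
have ltN : (i.+1 < N)%N by rewrite ltn_neqAle neN ltn_ord.
rewrite (bigD1 (Ordinal ltN)) //= rowK !mxE (negPf neN) eqxx scale1r.
rewrite big1 ?addr0 // => j; rewrite -val_eqE /= eq_sym => nej.
by rewrite !mxE (negPf neN) (negPf nej) scale0r.
Qed.

Lemma delta_compmx_exp N (f : {poly F}) (i : 'I_N.+1) :
  delta_mx 0 0 *m compmx N.+1 f ^+ i = delta_mx 0 i :> 'rV[F]_N.+1.
Proof.
case: i => i; elim: i => [|i IH] lti.
  by rewrite expr0 mulmx1; congr delta_mx; apply: val_inj.
have lti' := ltnW lti.
rewrite exprSr -mulmxE mulmxA (IH lti') -rowE; apply/rowP => j.
by rewrite !mxE /= (ltn_eqF lti) -val_eqE eq_sym.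
Qed.

(** The first basis vector is cyclic: [e_0 g(C)] is the row of coefficients of [g],
    for [g] of degree at most [N]. Hence a matrix that commutes with [C] is
    determined by its first row. *)
Lemma delta_horner_compmx N (f : {poly F}) (u : 'rV[F]_N.+1) :
  delta_mx 0 0 *m horner_mx (compmx N.+1 f) (rVpoly u) = u.
Proof.
rewrite -mul_krylov -[RHS]mulmx1; congr (_ *m _); apply/row_matrixP => i.
by rewrite rowK delta_compmx_exp row1.
Qed.

Lemma compmx_root N (f : {poly F}) : f \is monic -> size f = N.+2 ->
  horner_mx (compmx N.+1 f) f = 0.
Proof.
move=> mf sf; set C := compmx _ f.
have e0f : delta_mx 0 0 *m horner_mx C f = 0 :> 'rV[F]_N.+1.
  rewrite {1}(monic_rVpoly mf sf) rmorphD /= rmorphXn /= horner_mx_X mulmxDr.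
  rewrite delta_horner_compmx exprSr -mulmxE mulmxA.
  rewrite (delta_compmx_exp f (@Ordinal N.+1 N (leqnn _))) -rowE.
  by apply/rowP => j; rewrite !mxE /= eqxx addNr.
apply/row_matrixP => i; rewrite row0 rowE -(delta_compmx_exp f) -mulmxA.
have /= -> := @comm_mx_horner _ _ (C ^+ i) C f (commr_sym (commrX i (commr_refl C))).
by rewrite mulmxA e0f mul0mx.
Qed.

Lemma horner_compmx_eq0 N (f g : {poly F}) : f \is monic -> size f = N.+2 ->
  (horner_mx (compmx N.+1 f) g == 0) = (f %| g).
Proof.
move=> mf sf; have f0 : f != 0 by rewrite monic_neq0.
apply/eqP/idP=> [|/dvdpP[h ->]]; last first.
  by rewrite rmorphM /= compmx_root // mulr0.
rewrite {1}(divp_eq g f) rmorphD rmorphM /= compmx_root // mulr0 add0r => h0.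
have sz : (size (g %% f)%R <= N.+1)%N by rewrite -ltnS -sf ltn_modp.
apply/modp_eq0P; rewrite -(poly_rV_K sz).
by rewrite -[poly_rV _](delta_horner_compmx f) poly_rV_K // h0 mulmx0 linear0.
Qed.

(** The centralizer of a companion matrix consists of the polynomials in it. *)
Lemma comm_compmx N (f : {poly F}) (z : 'M[F]_N.+1) :
    comm_mx z (compmx N.+1 f) ->
  z = horner_mx (compmx N.+1 f) (rVpoly (delta_mx 0 0 *m z)).
Proof.
set C := compmx _ f => zC; set h := rVpoly _.
apply/row_matrixP => i; rewrite !rowE -(delta_compmx_exp f) -/C -!mulmxA.
have cCi y : comm_mx y C -> C ^+ i *m y = y *m C ^+ i.
  by move=> yC; apply/esym/commrX.
rewrite (cCi z) // (cCi (horner_mx C h)); last exact: comm_horner_mx.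
by rewrite !mulmxA delta_horner_compmx.
Qed.

Lemma horner_mx_comp n (C : 'M[F]_n.+1) (f g : {poly F}) :
  horner_mx (horner_mx C f) g = horner_mx C (g \Po f).
Proof.
elim/poly_ind: g => [|g c IH]; first by rewrite comp_poly0 !rmorph0.
rewrite comp_polyD comp_polyM comp_polyX comp_polyC !rmorphD !rmorphM /=.
by rewrite !horner_mx_C horner_mx_X IH.
Qed.

(** The divisors of [p ^+ k], for an irreducible [p], are powers of [p]. *)
Lemma irredp_dvd_exp (p f : {poly F}) k : irreducible_poly p ->
  ~~ (p ^+ k %| f) -> exists2 i, (i < k)%N & gcdp f (p ^+ k) %= p ^+ i.
Proof.
move=> irp; elim: k f => [|k IH] f; first by rewrite expr0 dvd1p.
move=> ndv; have [/dvdpP[g fE]|npf] := boolP (p %| f).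
  have p0 := irredp_neq0 irp.
  have [|i lti gi] := IH g.
    by move: ndv; rewrite fE exprSr dvdp_mul2r.
  exists i.+1 => //; rewrite fE !exprSr.
  by rewrite (eqp_trans (gcdp_mul2r _ _ _)) // eqp_mulr.
exists 0 => //; rewrite expr0 gcdp_eqp1.
by rewrite coprimep_expr // coprimep_sym irreducible_poly_coprime.
Qed.
End Krylov.

(** * Splitting off a cyclic primary block *)

Section PrimarySplitting.
Variable F : fieldType.
Implicit Types p f g : {poly F}.

Lemma irredp_factor f : (1 < size f)%N ->
  exists p, [/\ irreducible_poly p, p \is monic & p %| f].
Proof.
elim: {f}(size f) {-2}f (leqnn (size f)) => [|s IH] f; first by case: (size f).
move=> le_f f_gt1.
have [irf|nirf] := pselect (irreducible_poly f).
  have lf0 : (lead_coef f)^-1 != 0.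
    by rewrite invr_eq0 lead_coef_eq0 -size_poly_gt0 ltnW.
  exists ((lead_coef f)^-1 *: f); split; last by rewrite dvdpZl.
    split; first by rewrite size_scale //; apply: irf.
    move=> g sg; rewrite dvdpZr // => /(irf g sg) gf.
    by rewrite (eqp_trans gf) // eqp_sym eqp_scale.
  by rewrite monicE lead_coefZ mulVf // -invr_eq0.
have [g [sg1 gf ngf]] : exists g, [/\ size g != 1, g %| f & ~~ (g %= f)].
  apply/not_existsP => hg; apply: nirf; split=> // g sg gf.
  by have [//|ngf] := boolP (g %= f); case: (hg g).
have f0 : f != 0 by rewrite -size_poly_gt0 ltnW.
have g0 : g != 0 by apply: contraTneq gf => ->; rewrite dvd0p.
have ltgf : (size g < size f)%N.
  by rewrite ltn_neqAle (dvdp_leq f0 gf) andbT; apply: contra ngf; rewrite dvdp_size_eqp.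
have [||p [irp mp pg]] := IH g; last by exists p; split=> //; apply: dvdp_trans gf.
  by rewrite -ltnS (leq_trans ltgf).
by move: sg1 g0; rewrite -size_poly_gt0; case: (size g) => [|[]].
Qed.

Lemma max_irredp_exp p f : irreducible_poly p -> f != 0 ->
  exists k r, f = p ^+ k * r /\ ~~ (p %| r).
Proof.
move=> irp; elim: {f}(size f) {-2}f (leqnn (size f)) => [|s IH] f.
  by rewrite leqn0 size_poly_eq0 => ->.
move=> lef f0; have [/dvdpP[g fE]|npf] := boolP (p %| f); last first.
  by exists 0, f; rewrite expr0 mul1r.
have g0 : g != 0 by apply: contraNneq f0 => g0; rewrite fE g0 mul0r.
have [|k [r [gE npr]]] := IH g _ g0.
  rewrite -ltnS (leq_trans _ lef) // fE size_mul // ?irredp_neq0 //.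
  by have [sp _] := irp; move: sp; case: (size p) => [|[|z]] // _; rewrite !addnS ltnS leq_addr.
by exists k.+1, r; rewrite fE gE exprSr; split=> //; ring.
Qed.

Lemma horner_mxM n (x : 'M[F]_n.+1) f g :
  horner_mx x (f * g) = horner_mx x f *m horner_mx x g.
Proof. exact: rmorphM. Qed.

(** An ideal of [F[X]] containing [p ^+ k] and something that [p ^+ k] does not
    divide contains [p ^+ k.-1]. *)
Lemma ideal_irredp_exp (I : {poly F} -> Prop) p g k :
    (forall a b, I a -> I b -> I (a + b)) -> (forall a b, I b -> I (a * b)) ->
    irreducible_poly p -> I (p ^+ k) -> I g -> ~~ (p ^+ k %| g) ->
  I (p ^+ k.-1).
Proof.
move=> Iadd Imul irp Ipk Ig npg; have [i ltik gi] := irredp_dvd_exp irp npg.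
have [u ue] := Bezoutp g (p ^+ k).
have /dvdpP[w wE] : u.1 * g + u.2 * p ^+ k %| p ^+ k.-1.
  rewrite (eqp_dvdl _ ue) (eqp_dvdl _ gi) dvdp_exp2l //.
  by case: (k) ltik.
by rewrite wE; apply/Imul/Iadd; apply: Imul.
Qed.

(** If the annihilator of [v] is generated by [p ^+ k], the Krylov rows of [v] are
    free. *)
Lemma krylov_free p k N n (x : 'M[F]_n.+1) v :
    irreducible_poly p -> size (p ^+ k) = N.+1 ->
    v *m horner_mx x (p ^+ k) = 0 -> v *m horner_mx x (p ^+ k.-1) != 0 ->
  row_free (krylov N x v).
Proof.
move=> irp sp vpk vpk1; apply: inj_row_free => u; rewrite mul_krylov => vu0.
apply: contraNeq vpk1 => u0; apply/eqP.
pose I f := v *m horner_mx x f = 0.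
apply: (@ideal_irredp_exp I p (rVpoly u)) => //; rewrite /I.
- by move=> a b va vb; rewrite rmorphD mulmxDr va vb addr0.
- by move=> a b vb; rewrite mulrC rmorphM -mulmxE mulmxA vb mul0mx.
have ru0 : rVpoly u != 0.
  by apply: contraNneq u0 => ru0; rewrite -(rVpolyK u) ru0 linear0.
apply/negP => /(dvdp_leq ru0); rewrite sp leqNgt ltnS => /negP[].
exact: size_poly.
Qed.

(** A matrix whose minimal polynomial is [p ^+ k], of degree the size of the matrix,
    is similar to the companion matrix of [p ^+ k]. *)
Lemma primary_compmx p k N (y : 'M[F]_N.+1) :
    irreducible_poly p -> p \is monic -> size (p ^+ k) = N.+2 ->
    horner_mx y (p ^+ k) = 0 -> horner_mx y (p ^+ k.-1) != 0 ->
  exists2 h, h \in unitmx & h *m y = compmx N.+1 (p ^+ k) *m h.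
Proof.
move=> irp mp sp ypk ypk1.
have [i yi] : exists i, row i (horner_mx y (p ^+ k.-1)) != 0.
  apply/existsP; rewrite -negb_forall; apply: contra ypk1 => /forallP y0.
  by apply/eqP/row_matrixP => i; rewrite row0; apply/eqP.
exists (krylov N.+1 y (delta_mx 0 i)).
  by rewrite -row_free_unit (krylov_free irp sp) ?ypk ?mulmx0 // -rowE.
by apply: krylov_compmx => //; rewrite ?monic_exp // ypk mulmx0.
Qed.

(** Every matrix [x] has a cyclic invariant subspace, on which it acts as the
    companion matrix of a prime power [p ^+ k], with an [x]-stable complement.

    The power [p ^+ k] is taken maximal in the minimal polynomial of [x]. The
    complement is the annihilator of a cyclic submodule of the dual space, generated
    by a column [c] that pairs nontrivially with the generator [v] after
    multiplication by [p ^+ k.-1]. *)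
Lemma primary_splitting n (x : 'M[F]_n.+1) :
  exists p k N (K : 'M[F]_(N, n.+1)) (W : 'M[F]_n.+1),
    [/\ irreducible_poly p, p \is monic, (0 < k)%N & size (p ^+ k) = N.+1] /\
    [/\ row_free K, K *m x = compmx N (p ^+ k) *m K, stablemx W x,
        (K :&: W)%MS = 0 & (\rank W = n.+1 - N)%N].
Proof.
set m := mxminpoly x.
have m0 : m != 0 by rewrite monic_neq0 // mxminpoly_monic.
have [|p [irp mp pm]] := @irredp_factor m.
  by rewrite size_mxminpoly ltnS mxminpoly_nonconstant.
have [k [r [mE npr]]] := max_irredp_exp irp m0.
have k0 : (0 < k)%N.
  by rewrite lt0n; apply: contra npr => /eqP k0; move: pm; rewrite mE k0 expr0 mul1r.
have p0 := irredp_neq0 irp.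
have pk0 j : p ^+ j != 0 by rewrite expf_neq0.
have [N sN] : exists N, size (p ^+ k) = N.+1.
  by exists (size (p ^+ k)).-1; rewrite prednK // size_poly_gt0.
(* Since [m = p^k r] and [p] does not divide [r], the minimal polynomial does not
   divide [p^(k-1) r^2]. A nonzero entry [(i, j)] of the value of that polynomial
   at [x] provides both [v] and [c]. *)
have [i [j zij]] : exists i j, horner_mx x (p ^+ k.-1 * (r * r)) i j != 0.
  have : horner_mx x (p ^+ k.-1 * (r * r)) != 0.
    have r0 : r != 0 by apply: contraNneq npr => ->; rewrite dvdp0.
    by rewrite -dvd_mxminpoly -/m mE -{1}(prednK k0) exprSr -mulrA dvdp_mul2l // dvdp_mul2r.
  move=> nz; apply: contrapT => hz; case/eqP: nz; apply/matrixP => a b.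
  by rewrite [RHS]mxE; apply: contrapT => /eqP ab; case: hz; exists a, b.
pose v := delta_mx 0 i *m horner_mx x r : 'rV_n.+1.
pose c := horner_mx x r *m delta_mx j 0 : 'cV_n.+1.
(* The columns [c], [x c], ..., [x^(N-1) c]; the complement of the row space of
   [krylov N x v] is the left kernel of [K2]. *)
pose K2 := \matrix_(a < n.+1, b < N) (x ^+ b *m c) a 0.
have x_m : horner_mx x m = 0 by apply/eqP; rewrite -dvd_mxminpoly.
have vpk : v *m horner_mx x (p ^+ k) = 0.
  by rewrite /v -mulmxA -horner_mxM mulrC -mE x_m mulmx0.
have pkc : horner_mx x (p ^+ k) *m c = 0.
  by rewrite /c mulmxA -horner_mxM -mE x_m mul0mx.
have vpk1c : v *m horner_mx x (p ^+ k.-1) *m c != 0.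
  have -> : v *m horner_mx x (p ^+ k.-1) *m c
      = delta_mx 0 i *m horner_mx x (p ^+ k.-1 * (r * r)) *m delta_mx j 0.
    by rewrite /v /c mulrCA !horner_mxM !mulmxA.
  apply: contra zij => /eqP/matrixP/(_ 0 0).
  by rewrite -rowE -colE !mxE => ->.
clearbody v c.
have K2E (u : 'rV_N) : K2 *m u^T = horner_mx x (rVpoly u) *m c.
  apply/matrixP => a b; rewrite ord1 horner_mxE mulmx_suml summxE mxE.
  by apply: eq_bigr => l _; rewrite -scalemxAl !mxE mulrC.
have K2P (w : 'rV_n.+1) : w *m K2 = 0 <-> forall h, w *m horner_mx x h *m c = 0.
  split=> [wK h | wc].
    rewrite (divp_eq h (p ^+ k)) rmorphD /= horner_mxM mulmxDr mulmxDl.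
    rewrite -!mulmxA pkc !mulmx0 add0r.
    have sz : (size (h %% p ^+ k)%R <= N)%N by rewrite -ltnS -sN ltn_modp.
    by rewrite -(poly_rV_K sz) -K2E mulmxA wK mul0mx.
  apply/rowP => b; rewrite [RHS]mxE.
  have := wc 'X^b; rewrite rmorphXn /= horner_mx_X -mulmxA => /matrixP/(_ 0 0).
  by rewrite [RHS]mxE => <-; rewrite !mxE; apply: eq_bigr => a _; rewrite mxE.
(* The pairing between the Krylov rows of [v] and the Krylov columns of [c] is
   perfect. Otherwise the ideal of the [f] that make [v f(x)] orthogonal to all
   [h(x) c] would contain [p^(k-1)]. *)
have K12 (u : 'rV_N) : u *m krylov N x v *m K2 = 0 -> u = 0.
  rewrite mul_krylov => /K2P uv; apply: contraNeq vpk1c => u0; apply/eqP.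
  pose I f := forall h, v *m horner_mx x (f * h) *m c = 0.
  suff : I (p ^+ k.-1) by move=> /(_ 1); rewrite mulr1.
  apply: (@ideal_irredp_exp I p (rVpoly u)) => //; rewrite /I.
  - by move=> a b va vb h; rewrite mulrDl rmorphD mulmxDr mulmxDl va vb addr0.
  - by move=> a b vb h; rewrite [a * b]mulrC -mulrA vb.
  - by move=> h; rewrite horner_mxM mulmxA vpk !mul0mx.
  - by move=> h; rewrite horner_mxM mulmxA uv.
  have ru0 : rVpoly u != 0.
    by apply: contraNneq u0 => ru0; rewrite -(rVpolyK u) ru0 linear0.
  apply/negP => /(dvdp_leq ru0); rewrite sN leqNgt ltnS => /negP[].
  exact: size_poly.
exists p, k, N, (krylov N x v), (kermx K2); split; split=> //.
- by apply: inj_row_free => u uK; apply: K12; rewrite uK mul0mx.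
- by apply: krylov_compmx => //; rewrite monic_exp.
- apply/sub_kermxP/row_matrixP => a; rewrite row0 row_mul [row _ (_ *m x)]row_mul; apply/K2P => h.
  have rK : row a (kermx K2) *m K2 = 0 by rewrite -row_mul mulmx_ker row0.
  have := (K2P _).1 rK ('X * h); rewrite horner_mxM horner_mx_X.
  by rewrite mulmxA.
- apply/eqP/rowV0P => w; rewrite sub_capmx => /andP[/submxP[u ->] /sub_kermxP uK].
  by rewrite (K12 u uK) mul0mx.
rewrite mxrank_ker; congr (_ - _)%N; apply/eqP.
rewrite eqn_leq rank_leq_col /=.
have rK : \rank (krylov N x v *m K2) = N.
  by apply/eqP; apply: inj_row_free => u; rewrite mulmxA => /K12.
by apply: leq_trans (mxrankM_maxr (krylov N x v) K2); rewrite rK.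
Qed.
End PrimarySplitting.

(** * Primary decomposition *)

Section PrimaryDecomposition.
Variable F : fieldType.
Implicit Types p f g : {poly F}.

(** The triple [(d, k, V)] is a cyclic primary block of [x] in the subspace [S]: [V]
    is the (canonical generator matrix of the) row space of some [K] on which [x]
    acts as the companion matrix of [p ^+ k], with [p] monic irreducible of degree
    [d], and [V] has an [x]-stable complement [W] in [S]. The bound on the rank of
    [W] says that the sum of [V] and [W] is direct. *)
Definition primary_summand n (x : 'M[F]_n.+1) (S : 'M[F]_n.+1) (b : nat * nat * 'M[F]_n.+1) :=
  let: (d, k, V) := b in
  exists p (K : 'M[F]_(d * k, n.+1)) (W : 'M[F]_n.+1),
   [/\ irreducible_poly p, p \is monic, size p = d.+1 & (0 < k)%N] /\
   [/\ row_free K, K *m x = compmx (d * k) (p ^+ k) *m K & V = <<K>>%MS] /\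
   [/\ stablemx W x, (V + W :=: S)%MS & (\rank W <= \rank S - d * k)%N].

Lemma size_exp_monic p k d : p \is monic -> size p = d.+1 -> size (p ^+ k) = (d * k).+1.
Proof.
move=> mp sp; have := size_exp p k; rewrite sp /= => <-.
by rewrite prednK // size_poly_gt0 expf_neq0 // monic_neq0.
Qed.

(** An [x]-stable subspace [S] is filled by cyclic primary blocks, counted with
    their dimensions [d * k]. The spaces [V] are pairwise distinct, so that they can
    be told apart in counting arguments. *)
Lemma primary_decomposition_stable n (x : 'M[F]_n.+1) (S : 'M[F]_n.+1) :
  stablemx S x -> exists L : seq (nat * nat * 'M[F]_n.+1),
    [/\ (forall b, b \in L -> primary_summand x S b),
        uniq (map snd L) & (\sum_(b <- L) b.1.1 * b.1.2 = \rank S)%N].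
Proof.
(* The dimension count for the complement of a block of [W], enlarged by the block
   of dimension [N] that was split off from [S]. *)
have arith (a b c N r : nat) : (N <= r -> a <= b + N -> b <= r - N - c ->
    c <= r - N -> a <= r - c)%N by lia.
elim: {S}(\rank S) {-2}S (leqnn (\rank S)) => [|s IH] S.
  by rewrite leqn0 => /eqP S0 _; exists [::]; split; rewrite ?big_nil.
move=> leS Sx; have [S0|] := posnP (\rank S).
  by exists [::]; split; rewrite ?big_nil.
case rS : (\rank S) => [//|r] _.
have [R [Rfree RS]] : exists R : 'M[F]_(r.+1, n.+1), row_free R /\ (R :=: S)%MS.
  move: (row_base S) (row_base_free S) (eq_row_base S); rewrite rS => R Rf RS.
  by exists R.
(* The matrix of the restriction of [x] to [S] in the basis [R]. *)
pose y := R *m x *m pinvmx R.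
have yR : y *m R = R *m x.
  by rewrite /y mulmxKpV // (eqmx_stable x RS).
have [p [k [N [K0 [W0 [[irp mp k0 sN] [K0f K0y W0y KW0 rW0]]]]]]] := primary_splitting y.
have [d sp] : exists d, size p = d.+1.
  by exists (size p).-1; rewrite prednK // size_poly_gt0 irredp_neq0.
have d0 : (0 < d)%N by case: irp; rewrite sp ltnS.
have NE : N = (d * k)%N by apply/eqP; rewrite -eqSS -sN (size_exp_monic k mp sp).
subst N; set N := (d * k)%N in K0 K0f K0y KW0 rW0 sN *.
have N0 : (0 < N)%N by rewrite muln_gt0 d0.
have rK0 : \rank K0 = N by apply/eqP.
have leN : (N <= r.+1)%N by rewrite -rK0 rank_leq_col.
pose K := K0 *m R; pose W := <<W0 *m R>>%MS : 'M[F]_n.+1.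
have Kx : K *m x = compmx N (p ^+ k) *m K.
  by rewrite /K -mulmxA -yR mulmxA K0y !mulmxA.
have Kfree : row_free K by rewrite /row_free /K mxrankMfree // rK0.
have Wx : stablemx W x.
  by rewrite (eqmx_stable x (genmxE _)) -mulmxA -yR mulmxA submxMr.
have rW : \rank W = (r.+1 - N)%N by rewrite genmxE mxrankMfree.
have fullKW : row_full (K0 + W0)%MS.
  have := mxrank_sum_cap K0 W0; rewrite KW0 mxrank0 addn0 rK0 rW0 subnKC // => rs.
  by rewrite /row_full rs.
have KWS : (<<K>> + W :=: S)%MS.
  apply: eqmx_trans RS; apply: eqmx_trans (eqmxMfull R fullKW).
  apply: eqmx_trans (eqmx_sym (addsmxMr K0 W0 R)).
  exact: adds_eqmx (genmxE _) (genmxE _).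
have [|L [LP Lu Ls]] := IH W _ Wx.
  by move: leS N0; rewrite rW rS; move: (N) => N'; clear; lia.
exists ((d, k, <<K>>%MS) :: L); split.
- move=> b; rewrite inE => /predU1P[-> | bL].
    by exists p, K, W; split=> //; split=> //; split=> //; rewrite rW rS.
  case: b bL => [[d' k'] V'] /LP [p' [K' [W' [h1 [h2 [W'x VW' rW']]]]]].
  exists p', K', (W' + <<K>>)%MS; split=> //; split=> //; split.
  + by rewrite stableDmx // (eqmx_stable x (genmxE _)) Kx submxMl.
  + rewrite addsmxA; apply: eqmx_trans KWS.
    rewrite [X in (X :=: _)%MS]addsmxC; exact: adds_eqmx (eqmx_refl _) VW'.
  have rKW := mxrank_adds_leqif W' <<K>>%MS.
  have leV' : (d' * k' <= \rank W)%N.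
    have rK' : \rank K' = (d' * k')%N by case: h2 => /eqP.
    rewrite -rK' -(mxrank_gen K').
    by apply: mxrankS; rewrite -VW'; case: h2 => _ _ ->; apply: addsmxSl.
  move: rKW rW' leV'; rewrite (mxrank_gen K) (eqP Kfree) rW rS -/N.
  move: leN; rewrite -/N => leN [rKW _].
  by move=> h3 h4; exact: arith leN rKW h3 h4.
- rewrite /= Lu andbT; apply/negP => /mapP[[[d' k'] V'] /LP [p' [K' [W' [h1 [h2 [W'x VW'
  rW']]]]]]] /= VK.
  have : (K <= W)%MS.
    by rewrite -(genmxE K) VK -VW' addsmxSl.
  rewrite genmxE submxMfree // => K0W0.
  have : (K0 <= K0 :&: W0)%MS by rewrite sub_capmx submx_refl.
  by rewrite KW0 submx0 -mxrank_eq0 rK0 eqn0Ngt N0.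
by rewrite big_cons /= Ls rW subnKC.
Qed.

Lemma primary_decomposition n (x : 'M[F]_n.+1) :
  exists L : seq (nat * nat * 'M[F]_n.+1),
    [/\ (forall b, b \in L -> primary_summand x 1%:M b),
        uniq (map snd L) & (\sum_(b <- L) b.1.1 * b.1.2 = n.+1)%N].
Proof.
have [|L [LP uL sL]] := @primary_decomposition_stable n x 1%:M.
  by rewrite mul1mx submx1.
by exists L; split=> //; rewrite sL mxrank1.
Qed.
End PrimaryDecomposition.

(** * The residue field of an irreducible polynomial *)

Section QuotientField.
Variables (F : finFieldType) (p : {poly F}).
Hypothesis pI : monic_irreducible_poly p.
Local Notation K := {poly %/ p with pI}.

(** The projection from [F[X]] onto the field [F[X]/(p)]. *)
Definition qfproj : {poly F} -> K := in_qpoly p.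

Lemma qfproj_is_zmod_morphism : zmod_morphism qfproj.
Proof. by move=> f g; rewrite /qfproj linearB. Qed.

Lemma qfproj_is_monoid_morphism : monoid_morphism qfproj.
Proof. by split=> [|f g]; rewrite /qfproj ?in_qpoly1 ?in_qpolyM. Qed.

HB.instance Definition _ :=
  GRing.isZmodMorphism.Build {poly F} K qfproj qfproj_is_zmod_morphism.
HB.instance Definition _ :=
  GRing.isMonoidMorphism.Build {poly F} K qfproj qfproj_is_monoid_morphism.

Lemma qfproj_eq0 f : (qfproj f == 0) = (p %| f).
Proof.
rewrite /dvdp -val_eqE /= (mk_monicE pI).
by rewrite Pdiv.IdomainMonic.modpE //; apply: pI.2.
Qed.

Lemma qfproj_val (a : K) : qfproj (a : {poly F}) = a.
Proof. by apply: val_inj; apply: in_qpoly_small; apply: size_mk_monic. Qed.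

Lemma qfproj_comp (f g : {poly F}) :
  qfproj (g \Po f) = (map_poly (qfproj \o polyC) g).[qfproj f].
Proof. by rewrite /comp_poly -horner_map -map_poly_comp. Qed.

(** By Fermat's theorem in [F[X]/(p)], an irreducible polynomial of degree [d]
    divides [X^(q^d) - X]. *)
Lemma qfproj_expX : p %| 'X^(#|F| ^ (size p).-1) - 'X.
Proof.
rewrite -qfproj_eq0 rmorphB rmorphXn /= -(card_qfpoly pI) expf_card subrr //.
Qed.
End QuotientField.

(** * Roots of irreducible polynomials modulo prime powers *)

Section CountRoots.
Variable F : finFieldType.
Implicit Types p f g : {poly F}.
Local Notation q := #|F|.

Lemma natr_card_finField : q%:R = 0 :> F.
Proof.
have : \sum_(x : F) x = \sum_(x : F) x + q%:R.
  by rewrite {1}(reindex_inj (addIr 1)) big_split sumr_const.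
by move/eqP; rewrite -subr_eq0 opprD addNKr oppr_eq0 => /eqP.
Qed.

(** Irreducible polynomials over a finite field are separable: a root [f] of [p']
    modulo [p] is simple. The reason is that [p'] divides [X^(q^d) - X], whose
    derivative is [-1]. *)
Lemma comp_irredp_deriv_ndvd p p' f d :
    monic_irreducible_poly p -> monic_irreducible_poly p' -> size p' = d.+1 ->
  p %| p' \Po f -> ~~ (p %| p'^`() \Po f).
Proof.
move=> pI p'I sp' pf; apply/negP => pdf.
have d0 : (0 < d)%N by case: p'I => -[]; rewrite sp' ltnS.
have /dvdpP[h /(congr1 deriv)] := qfproj_expX p'I; rewrite sp' /=.
have -> : ('X^(q ^ d) - 'X)^`() = - 1 :> {poly F}.
  rewrite derivB derivX derivXn -mulr_natr -polyC_natr natrX natr_card_finField.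
  by rewrite expr0n eqn0Ngt d0 polyC0 mulr0 sub0r.
move=> /(congr1 (comp_poly f)); rewrite derivM rmorphN rmorph1 /= rmorphD !rmorphM /= => h1.
have : p %| - 1 by rewrite h1 dvdp_add // dvdp_mull.
rewrite dvdpNr dvdp1; case: pI => -[sp _] _.
by rewrite gtn_eqF.
Qed.

(** Two irreducible polynomials of the same degree [d] define the same field, so
    [p'] has [d] roots modulo [p]. Residues are represented by polynomials of degree
    less than [d]. *)
Lemma card_rVpoly_root p p' d :
    monic_irreducible_poly p -> monic_irreducible_poly p' ->
    size p = d.+1 -> size p' = d.+1 ->
  (d <= #|[set f : 'rV[F]_d | (p %| p' \Po rVpoly f)%R]|)%N.
Proof.
move=> pI p'I sp sp'; pose K : finFieldType := {poly %/ p with pI}.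
pose j := (qfproj pI \o polyC : F -> K).
have cK : #|K| = (q ^ d)%N by rewrite card_qfpoly sp.
(* All elements of [K] are roots of [X^#|K| - X], so its divisor [p'] splits into
   distinct linear factors over [K]. *)
have p'X : map_poly j p' %| 'X^#|K| - 'X.
  have := qfproj_expX p'I; rewrite -(dvdp_map j) sp' -cK.
  by rewrite rmorphB /= map_polyXn map_polyX.
move: p'X; rewrite finField_genPoly -big_enum /= => /dvdp_prod_XsubC[m p'E].
set s := mask m (enum K) in p'E.
have us : uniq s by rewrite mask_uniq ?enum_uniq.
have ss : size s = d.
  by have := eqp_size p'E; rewrite size_map_poly sp' size_prod_XsubC => -[].
pose h (a : K) : 'rV[F]_d := poly_rV (a : {poly F}).
have hK (a : K) : rVpoly (h a) = a :> {poly F}.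
  have smk : size (mk_monic p) = d.+1 by rewrite (mk_monicE pI).
  by apply: poly_rV_K; rewrite -ltnS -smk; apply: size_mk_monic.
have hi : injective h.
  by move=> a b /(congr1 rVpoly); rewrite !hK => /val_inj.
have cs : d = #|h @: s| by rewrite (card_imset _ hi) (card_uniqP us).
rewrite [X in (X <= _)%N]cs; apply: subset_leq_card; apply/fintype.subsetP => _ /imsetP[a sa ->].
rewrite inE hK -(qfproj_eq0 pI) qfproj_comp qfproj_val -rootE.
by rewrite (eqp_root p'E) root_prod_XsubC.
Qed.

(** Taylor expansion to first order: [g (a + b) = g a + b g' a] modulo [b^2]. *)
Lemma comp_poly_taylor (g a b : {poly F}) :
  b * b %| (g \Po (a + b)) - (g \Po a) - b * (g^`() \Po a).
Proof.
elim/poly_ind: g => [|g c IH].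
  by rewrite deriv0 !comp_poly0 mulr0 !subr0 dvdp0.
rewrite derivD derivM derivC derivX addr0 mulr1.
rewrite !(comp_polyD, comp_polyM, comp_polyX, comp_polyC).
set u := g \Po (a + b) in IH *; set v := g \Po a in IH *.
set w := g^`() \Po a in IH *.
have -> : u * (a + b) + c%:P - (v * a + c%:P) - b * (w * a + v)
  = (u - v - b * w) * (a + b) + b * b * w by ring.
by rewrite dvdp_add // dvdp_mulr.
Qed.

(** The first digit in base [p] is determined, as in Euclidean division. *)
Lemma base_expansion_inj p d f0 f1 g0 g1 : size p = d.+1 ->
    (size f0 <= d)%N -> (size f1 <= d)%N ->
  f0 + p * g0 = f1 + p * g1 -> f0 = f1 /\ g0 = g1.
Proof.
move=> sp s0 s1 e.
have p0 : p != 0 by rewrite -size_poly_eq0 sp.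
have e' : f0 - f1 = p * (g1 - g0).
  by apply/eqP; rewrite -subr_eq0; apply/eqP; transitivity (f0 + p * g0 - (f1 + p * g1));
    [ring|rewrite e subrr].
have e0 : f0 - f1 = 0.
  apply/eqP/contraT => nz; have : p %| f0 - f1 by rewrite e' dvdp_mulIl.
  move=> /(dvdp_leq nz); rewrite sp leqNgt ltnS.
  by rewrite (leq_trans (size_polyD _ _)) // size_polyN geq_max s0.
move: e'; rewrite e0 => /esym/eqP; rewrite mulf_eq0 (negPf p0) /= subr_eq0.
by move=> /eqP->; split=> //; apply/eqP; rewrite -subr_eq0 e0.
Qed.

(** The polynomials of degree less than [N] that are prime to the irreducible [p];
    for [N] the degree of [p ^+ k], these are the units of [F[X]/(p^k)]. *)
Definition coprime_rV p N : {set 'rV[F]_N} := [set u | ~~ (p %| rVpoly u)].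

(** The polynomials [f] of degree less than [N] with [p] dividing [p'(f)] and,
    unless [k = 1], with [p^2] not dividing [p'(f)]. For [N] the degree of [p ^+ k],
    these are the residues modulo [p ^+ k] whose minimal polynomial is [p' ^+ k]. *)
Definition lift_rV p p' k N : {set 'rV[F]_N} :=
  [set f | (p %| p' \Po rVpoly f) && ((k == 1%N) || ~~ (p * p %| p' \Po rVpoly f))].

Lemma size_base_expansion p d m f g : size p = d.+1 ->
  (size f <= d)%N -> (size g <= d * m)%N -> (size (f + p * g)%R <= d * m.+1)%N.
Proof.
move=> sp sf sg; rewrite (leq_trans (size_polyD _ _)) // geq_max.
rewrite (leq_trans sf) ?leq_pmulr //= (leq_trans (size_polyMleq _ _)) //.
by rewrite sp addSn /= mulnS leq_add2l.
Qed.

Lemma card_coprime_rV p d k : size p = d.+1 ->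
  ((q ^ d - 1) * q ^ (d * k) <= #|coprime_rV p (d * k.+1)|)%N.
Proof.
move=> sp; pose A : {set 'rV[F]_d * 'rV[F]_(d * k)} := [set t | t.1 != 0].
pose h (t : 'rV[F]_d * 'rV[F]_(d * k)) : 'rV[F]_(d * k.+1) :=
  poly_rV (rVpoly t.1 + p * rVpoly t.2).
have hE t : rVpoly (h t) = rVpoly t.1 + p * rVpoly t.2.
  by apply/poly_rV_K/size_base_expansion; rewrite ?size_poly.
have hi : injective h.
  move=> [u v] [u' v'] /(congr1 rVpoly); rewrite !hE => /(base_expansion_inj sp).
  rewrite !size_poly => /(_ isT isT)[/(can_inj rVpolyK) /= -> /(can_inj rVpolyK) /= ->].
  by [].
have cA : #|A| = ((q ^ d - 1) * q ^ (d * k))%N.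
  have -> : A = finset.setX [set~ 0] finset.setT by apply/setP => t; rewrite !inE andbT.
  by rewrite cardsX cardsT cardsC1 !card_mx !mul1n subn1.
rewrite -cA -(card_imset _ hi).
apply: subset_leq_card; apply/fintype.subsetP => _ /imsetP[[u v] uA ->].
move: uA; rewrite !inE hE /= => u0; rewrite dvdp_addl ?dvdp_mulIl //.
have ru0 : rVpoly u != 0.
  by apply: contraNneq u0 => e; rewrite -(rVpolyK u) e linear0.
by apply/negP => /(dvdp_leq ru0); rewrite sp leqNgt ltnS size_poly.
Qed.

(** Writing [f = u + p w + p^2 v], the digit [u] is one of the [d] roots of [p']
    modulo [p], and for given [u] and [v] at most one [w] is excluded, because the
    root [u] is simple. *)
Lemma card_lift_rV p p' d k :
    monic_irreducible_poly p -> monic_irreducible_poly p' ->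
    size p = d.+1 -> size p' = d.+1 ->
  (d * ((q ^ d - 1) * q ^ (d * k)) <= #|lift_rV p p' k.+2 (d * k.+2)|)%N.
Proof.
move=> pI p'I sp sp'; have p0 : p != 0 by rewrite -size_poly_eq0 sp.
pose T := ('rV[F]_d * 'rV[F]_(d * k) * 'rV[F]_d)%type.
pose P (t : T) : {poly F} :=
  rVpoly t.1.1 + p * (rVpoly t.2 + p * rVpoly t.1.2).
pose good t := ~~ (p * p %| p' \Po P t).
pose A : {set 'rV[F]_d * 'rV[F]_(d * k) * 'rV[F]_d} := [set t | (p %| p' \Po rVpoly t.1.1) &&
  good t].
pose h (t : T) : 'rV[F]_(d * k.+2) := poly_rV (P t).
have sP1 (t : T) : (size (rVpoly t.2 + p * rVpoly t.1.2)%R <= d * k.+1)%N.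
  by apply: size_base_expansion; rewrite ?size_poly.
have hE (t : T) : rVpoly (h t) = P t.
  by apply/poly_rV_K/size_base_expansion; rewrite ?size_poly.
have hi : injective h.
  move=> [[u v] w] [[u' v'] w'] /(congr1 rVpoly); rewrite !hE => /(base_expansion_inj sp).
  rewrite !size_poly => /(_ isT isT)[/= /(can_inj rVpolyK) -> /(base_expansion_inj sp)].
  rewrite !size_poly => /(_ isT isT)[/(can_inj rVpolyK) /= -> /(can_inj rVpolyK) /= ->].
  by [].
have dvP (t : T) : (p %| p' \Po P t) = (p %| p' \Po rVpoly t.1.1).
  have := comp_poly_taylor p' (rVpoly t.1.1) (p * (rVpoly t.2 + p * rVpoly t.1.2)).
  rewrite -/(P t); set b := _ + p * _ => taylor.
  have pd : p %| (p' \Po P t) - (p' \Po rVpoly t.1.1).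
    rewrite -[X in p %| X](subrK (p * b * (p'^`() \Po rVpoly t.1.1))).
    apply: dvdp_add; last by rewrite -mulrA dvdp_mulIl.
    by apply: dvdp_trans taylor; rewrite -mulrA dvdp_mulIl.
  by rewrite -[p' \Po P t](subrK (p' \Po rVpoly t.1.1)) dvdp_addr.
(* With [b = w + p v] and [e] the value at [u] of the derivative of [p'], Taylor
   expansion gives [p'(u + p b) = p'(u) + p b e] modulo [p^2]. As [e] is prime to
   [p], divisibility by [p^2] determines [b] modulo [p], that is, [w]. *)
have bad (u : 'rV[F]_d) (v : 'rV[F]_(d * k)) : p %| p' \Po rVpoly u ->
    (#|[set w | ~~ good (u, v, w)]| <= 1)%N.
  move=> pu; apply/card_le1_eqP => w w'; rewrite !inE !negbK => bw bw'.
  have Tay (w1 : 'rV[F]_d) := comp_poly_taylor p' (rVpoly u) (p * (rVpoly w1 + p * rVpoly v)).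
  have key (w1 : 'rV[F]_d) : p * p %| p' \Po P (u, v, w1) ->
     p * p %| (p' \Po rVpoly u) + p * (rVpoly w1 + p * rVpoly v) * (p'^`() \Po rVpoly u).
    move=> b1; have := Tay w1; rewrite -/(P (u, v, w1)).
    set b := _ + p * _ => T1.
    have {}T1 : p * p %| (p' \Po P (u, v, w1)) - (p' \Po rVpoly u) - p * b * (p'^`() \Po rVpoly u).
      by apply: dvdp_trans T1; rewrite mulrACA dvdp_mulIl.
    by move: T1; rewrite -addrA -opprD dvdp_subr.
  have := dvdp_sub (key w bw) (key w' bw').
  set e := p'^`() \Po _; rewrite [X in _ %| X](_ : _ = p * ((rVpoly w - rVpoly w') * e));
    last by ring.
  rewrite dvdp_mul2l // Gauss_dvdpl; last first.
    by rewrite irreducible_poly_coprime;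
      [exact: (comp_irredp_deriv_ndvd pI p'I sp' pu)|exact: pI.1].
  move=> pw; apply/esym/(can_inj rVpolyK)/eqP; rewrite -subr_eq0; apply: contraTT pw => nz.
  apply/negP => /(dvdp_leq nz); rewrite sp leqNgt ltnS.
  by rewrite (leq_trans (size_polyD _ _)) // size_polyN geq_max !size_poly.
have cA : (#|[set u : 'rV[F]_d | (p %| p' \Po rVpoly u)%R]| * ((q ^ d - 1) * q ^ (d * k)) <=
  #|A|)%N.
  have -> : (#|A| = \sum_(uv : 'rV[F]_d * 'rV[F]_(d * k) | (p %| p' \Po rVpoly uv.1)%R)
      \sum_(w | good (uv, w)) 1)%N.
    by rewrite -sum1_card pair_big_dep; apply: eq_bigl => -[[u v] w]; rewrite inE.
  have le1 (uv : 'rV[F]_d * 'rV[F]_(d * k)) : (p %| p' \Po rVpoly uv.1)%R ->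
      (q ^ d - 1 <= \sum_(w | good (uv, w)) 1)%N.
    case: uv => u v /= pu; rewrite sum1_card.
    have := bad u v pu; have := cardC (fun w => good (u, v, w)).
    rewrite !card_mx mul1n => <- b1; rewrite leq_subLR [X in (_ <= X)%N]addnC leq_add2l.
    by move: b1; rewrite cardsE.
  apply: leq_trans (leq_sum _ le1).
  rewrite sum_nat_const mulnCA mulnC leq_mul2r; apply/orP; right.
  have <- : #|finset.setX [set u : 'rV[F]_d | (p %| p' \Po rVpoly u)%R] [set: 'rV[F]_(d * k)]| =
         #|[pred uv : 'rV[F]_d * 'rV[F]_(d * k) | (p %| p' \Po rVpoly uv.1)%R]|.
    by apply: eq_card => uv; rewrite !inE andbT.
  by rewrite cardsX cardsT card_mx mul1n.
apply: leq_trans (leq_trans cA _).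
  by rewrite leq_mul2r card_rVpoly_root ?orbT.
rewrite -(card_imset _ hi); apply: subset_leq_card.
apply/fintype.subsetP => _ /imsetP[t tA ->].
by move: tA; rewrite !inE hE dvP.
Qed.
End CountRoots.

(** * Pairs of matrices adapted to a primary block *)

Section AdaptedPairs.
Variable F : finFieldType.
Implicit Types p : {poly F}.

(** The invertible matrices as a set of matrices; in dimension 0 it has one element,
    whereas ['GL_0[F]] is ['GL_1[F]]. *)
Definition unit_mxs n : {set 'M[F]_n} := [set u | u \in unitmx].

(** The pairs [(A, B)] adapted to [x]: the rows of [A] and of [B] together are free,
    the row space of [B] is [x]-stable, and [x] acts on the rows of [A] through a
    matrix [z] commuting with [C]. The matrix [C] does not depend on [x]. *)
Definition adapted N M n (C : 'M[F]_N) (x : 'M[F]_n) : {set 'M[F]_(N, n) * 'M[F]_(M, n)} :=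
  [set AB | [&& row_free (col_mx AB.1 AB.2), stablemx AB.2 x &
     [exists z : 'M[F]_N, (z *m C == C *m z) && (AB.1 *m x == z *m AB.1)]]].

Lemma horner_compmx_inj N (f g g' : {poly F}) : f \is monic -> size f = N.+2 ->
    (size g <= N.+1)%N -> (size g' <= N.+1)%N ->
  horner_mx (compmx N.+1 f) g = horner_mx (compmx N.+1 f) g' -> g = g'.
Proof.
move=> mf sf sg sg' /eqP; rewrite -subr_eq0 -rmorphB /= horner_compmx_eq0 //.
move=> fg; apply/eqP; rewrite -subr_eq0; apply: contraTT fg => nz.
apply/negP => /(dvdp_leq nz); rewrite sf leqNgt ltnS.
by rewrite (leq_trans (size_polyD _ _)) // size_polyN geq_max sg.
Qed.

Lemma horner_compmx_unit N (f g : {poly F}) : f \is monic -> size f = N.+2 ->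
  coprimep g f -> horner_mx (compmx N.+1 f) g \in unitmx.
Proof.
move=> mf sf /Bezout_eq1_coprimepP[[a b] /= /(congr1 (horner_mx (compmx N.+1 f)))].
rewrite rmorphD rmorph1 /= !horner_mxM compmx_root // mulmx0 addr0.
by move=> /mulmx1_unit[].
Qed.

(** A residue [f] in [lift_rV] gives a matrix [f(C)] with minimal polynomial exactly
    [p' ^+ k], where [C] is the companion matrix of [p ^+ k]. *)
Lemma lift_rV_primary p p' k N (f : 'rV[F]_N.+1) :
    irreducible_poly p -> p \is monic -> size (p ^+ k) = N.+2 -> (0 < k)%N ->
    f \in lift_rV p p' k N.+1 ->
  let y := horner_mx (compmx N.+1 (p ^+ k)) (rVpoly f) in
  horner_mx y (p' ^+ k) = 0 /\ horner_mx y (p' ^+ k.-1) != 0.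
Proof.
move=> irp mp sp k0; rewrite inE => /andP[pf npf] y.
have p0 := irredp_neq0 irp.
have mpk : p ^+ k \is monic by rewrite monic_exp.
have /dvdpP[w wE] := pf.
have e j : (p' ^+ j) \Po rVpoly f = w ^+ j * p ^+ j by rewrite rmorphXn /= wE exprMn.
split; first by apply/eqP; rewrite horner_mx_comp horner_compmx_eq0 // e dvdp_mulIr.
rewrite horner_mx_comp horner_compmx_eq0 // e; case: k {y} k0 npf {sp mpk} => // k _.
rewrite /= exprSr [w ^+ k * _]mulrC dvdp_mul2l ?expf_neq0 //.
case: k => [_|k /=]; first by rewrite expr0 dvdp1 gtn_eqF ?irp.
rewrite wE dvdp_mul2r // => npw; rewrite -irreducible_poly_coprime //.
by rewrite coprimep_expr // irreducible_poly_coprime.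
Qed.

Lemma row_free_col_mx_mul N M n (K : 'M[F]_(N, n)) (B : 'M[F]_(M, n))
    (P : 'M[F]_N) (g : 'M[F]_M) :
    row_free (col_mx K B) -> P \in unitmx -> g \in unitmx ->
  row_free (col_mx (P *m K) (g *m B)).
Proof.
move=> KBf Pu gu; apply: inj_row_free => u.
rewrite -[u]hsubmxK mul_row_col !mulmxA -mul_row_col => /eqP.
rewrite mulmx_free_eq0 // -row_mx0 => /eqP/eq_row_mx[uP ug].
by rewrite -[lsubmx u](mulmxK Pu) uP -[rsubmx u](mulmxK gu) ug !mul0mx.
Qed.

Lemma row_free_col_mxl N M n (K : 'M[F]_(N, n)) (B : 'M[F]_(M, n)) :
  row_free (col_mx K B) -> row_free K.
Proof.
move=> KBf; apply: inj_row_free => u uK; have /eqP := mul_row_col u 0 K B.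
rewrite uK mul0mx addr0 mulmx_free_eq0 // -row_mx0 => /eqP/eq_row_mx[].
by [].
Qed.

Lemma row_free_col_mxr N M n (K : 'M[F]_(N, n)) (B : 'M[F]_(M, n)) :
  row_free (col_mx K B) -> row_free B.
Proof.
move=> KBf; apply: inj_row_free => u uK; have /eqP := mul_row_col 0 u K B.
rewrite uK mul0mx addr0 mulmx_free_eq0 // -row_mx0 => /eqP/eq_row_mx[].
by [].
Qed.

(** A block [K] of [x] with characteristic polynomial [p' ^+ k] and stable
    complement [B] yields many adapted pairs: the matrix [f(C)], for [f] in
    [lift_rV], is similar to the companion matrix of [p' ^+ k], so [K] can be
    replaced by a basis of its row space on which [x] acts as [f(C)]. That basis is
    multiplied by a unit [u(C)], and [B] is multiplied by an invertible matrix. All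
    these pairs have the same row space of [A] as [K]. *)
Lemma card_adapted_block p p' k N M n (x : 'M[F]_n.+1) (K : 'M[F]_(N.+1, n.+1)) (B : 'M[F]_(M,
  n.+1)) :
    irreducible_poly p -> p \is monic -> size (p ^+ k) = N.+2 -> (0 < k)%N ->
    irreducible_poly p' -> p' \is monic -> size (p' ^+ k) = N.+2 ->
    row_free (col_mx K B) ->
    K *m x = compmx N.+1 (p' ^+ k) *m K -> stablemx B x ->
  (#|coprime_rV p N.+1| * #|lift_rV p p' k N.+1| * #|unit_mxs M| <=
   #|[set AB in adapted M (compmx N.+1 (p ^+ k)) x | <<AB.1>>%MS == <<K>>%MS]|)%N.
Proof.
move=> irp mp sp k0 irp' mp' sp' KBf Kx Bx.
set C := compmx N.+1 (p ^+ k); set C' := compmx N.+1 (p' ^+ k) in Kx *.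
have mpk : p ^+ k \is monic by rewrite monic_exp.
have Kf := row_free_col_mxl KBf; have Bf := row_free_col_mxr KBf.
pose y (f : 'rV[F]_N.+1) := horner_mx C (rVpoly f).
(* A chosen conjugator from [f(C)] to the companion matrix of [p' ^+ k]. *)
pose hf f : 'M[F]_N.+1 :=
  odflt 1%:M [pick h | (h \in unitmx) && (h *m y f == C' *m h)].
have hfP f : f \in lift_rV p p' k N.+1 ->
    hf f \in unitmx /\ invmx (hf f) *m C' = y f *m invmx (hf f).
  move=> /(lift_rV_primary irp mp sp k0)[y0 y1].
  have [h hu hy] := primary_compmx irp' mp' sp' y0 y1.
  rewrite /hf; case: pickP => [h' /andP[h'u /eqP h'y] | /(_ h)]; last by rewrite hu hy eqxx.
  by split=> //=; rewrite -[LHS](mulmxK h'u) -[_ *m C' *m h']mulmxA -h'y mulmxA mulVmx // mul1mx.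
have yu u : u \in coprime_rV p N.+1 -> y u \in unitmx.
  rewrite inE => npu; apply: horner_compmx_unit => //.
  by rewrite coprimep_expr // coprimep_sym irreducible_poly_coprime.
have yi : injective y.
  by move=> u v /(horner_compmx_inj mpk sp (size_poly _ _) (size_poly _ _))/(can_inj rVpolyK).
pose dom := finset.setX (finset.setX (coprime_rV p N.+1) (lift_rV p p' k N.+1)) (unit_mxs M).
pose Phi (t : 'rV[F]_N.+1 * 'rV[F]_N.+1 * 'M[F]_M) : 'M[F]_(N.+1, n.+1) * 'M[F]_(M, n.+1) :=
  (y t.1.1 *m invmx (hf t.1.2) *m K, t.2 *m B).
have PhiE t : t \in dom -> (Phi t).1 *m x = y t.1.2 *m (Phi t).1.
  case: t => [[u f] g]; rewrite !finset.in_setX /= => /andP[/andP[uu /hfP[hu hC]] _].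
  rewrite /Phi /= -!mulmxA Kx [invmx _ *m (C' *m K)]mulmxA hC !mulmxA.
  by rewrite /y -!horner_mxM mulrC.
rewrite -!cardsX -/dom.
have Phi_inj : {in dom &, injective Phi}.
  move=> t t' td td' e; have e1 := congr1 fst e; have e2 := congr1 snd e.
  have Af : row_free (Phi t').1.
    case: {e e1 e2} t' td' => [[u f] g];
      rewrite !finset.in_setX /= => /andP[/andP[/yu uu /hfP[hu hC]] _].
    by rewrite /row_free mxrankMfree // mxrank_unit // unitmx_mul uu unitmx_inv.
  (* The action of [x] on the free rows [A] determines [f]; then the pair
     determines [u] and the second factor. *)
  have ef : t.1.2 = t'.1.2.
    by have := PhiE t td; rewrite e1 (PhiE _ td') => /(row_free_inj Af)/yi ->.
  case: t t' td td' ef {e Af} e1 e2 => [[u f] g] [[u' f'] g'].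
  rewrite !finset.in_setX /= => /andP[/andP[uu ff] _] _ ef; rewrite -ef.
  have [hu _] := hfP f ff.
  move=> /(row_free_inj Kf) e1 /(row_free_inj Bf) ->.
  by have := congr1 (mulmxr (hf f)) e1; rewrite /= !mulmxKV // => /yi ->.
rewrite -(card_in_imset Phi_inj); apply: subset_leq_card.
apply/fintype.subsetP => _ /imsetP[t td ->].
have := PhiE t td; case: t td => [[u f] g]; rewrite !finset.in_setX.
move=> /andP[/andP[/= uu ff] gu] ptE; have [hu hC] := hfP _ ff.
rewrite inE in gu; rewrite inE; apply/andP; split; last first.
  apply/eqP/eq_genmx/eqmxMfull.
  by rewrite row_full_unit unitmx_mul yu // unitmx_inv.
rewrite inE; apply/and3P; split.
- by apply: row_free_col_mx_mul => //; rewrite unitmx_mul yu // unitmx_inv.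
- by rewrite (eqmx_stable x (eqmxMfull B _)) // row_full_unit.
apply/existsP; exists (y f); rewrite ptE eqxx andbT; apply/eqP.
exact: comm_horner_mx.
Qed.
End AdaptedPairs.

(** * Double counting of adapted pairs *)

Section Recursion.
Variable F : finFieldType.
Implicit Types p : {poly F}.
Local Notation q := #|F|.

(** Fibers of [f] over distinct points are disjoint. *)
Lemma sum_card_fibers (T U : finType) (A : {set T}) (f : T -> U) (s : seq U) :
  uniq s -> (\sum_(v <- s) #|[set a in A | f a == v]| <= #|A|)%N.
Proof.
move=> us; rewrite big_uniq //=.
have -> : (#|A| = \sum_(v : U) #|[set a in A | f a == v]|)%N.
  rewrite -sum1_card (partition_big f predT) //=; apply: eq_bigr => v _.
  by rewrite -sum1_card; apply: eq_bigl => a; rewrite inE.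
by rewrite [X in (_ <= X)%N](bigID (mem s)) /= leq_addr.
Qed.

(** A lower bound for the number of pairs [(u, f)] that a block of type [(d, k)]
    provides: with [Q = q^d], there are [(Q-1) Q^(k-1)] units [u] of [F[X]/(p^k)],
    and at least [d] residues [f] if [k = 1] and [d (Q-1) Q^(k-2)] if [k > 1]. *)
Definition block_weight d k : nat :=
  ((q ^ d - 1) * q ^ (d * k.-1)) *
  (d * (if k == 1 then 1 else (q ^ d - 1) * q ^ (d * k.-2)))%N.

Lemma block_weight_le p p' d k : (0 < k)%N ->
    monic_irreducible_poly p -> monic_irreducible_poly p' ->
    size p = d.+1 -> size p' = d.+1 ->
  (block_weight d k <= #|coprime_rV p (d * k)| * #|lift_rV p p' k (d * k)|)%N.
Proof.
case: k => // k _ pI p'I sp sp'; apply: leq_mul; first exact: card_coprime_rV.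
case: k => [|k]; last exact: card_lift_rV.
rewrite eqxx !muln1; apply: leq_trans (card_rVpoly_root pI p'I sp sp') _.
by apply: subset_leq_card; apply/fintype.subsetP => f; rewrite !inE eqxx andbT.
Qed.

Lemma block_weight_gt0 d k : (0 < d)%N -> (0 < block_weight d k)%N.
Proof.
move=> d0; have q1 : (1 < q)%N := finNzRing_gt1 F.
have qd : (0 < q ^ d - 1)%N by rewrite subn_gt0 -{1}(exp1n d) ltn_exp2r.
have qm m : (0 < q ^ m)%N by rewrite expn_gt0 ltnW.
by rewrite /block_weight !muln_gt0 qd qm d0; case: ifP; rewrite ?muln_gt0 ?qd ?qm.
Qed.

(** A choice of one monic irreducible polynomial [P d] in each degree [d] in which
    there is one. (There is one in every positive degree, but this is not needed.) *)
Definition irreducible_family (P : nat -> {poly F}) :=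
  forall d p', monic_irreducible_poly p' -> size p' = d.+1 ->
    monic_irreducible_poly (P d) /\ size (P d) = d.+1.

Lemma irreducible_family_ex : exists P, irreducible_family P.
Proof.
have h d : exists p, forall p', monic_irreducible_poly p' -> size p' = d.+1 ->
    monic_irreducible_poly p /\ size p = d.+1.
  have [[p hp]|hp] := pselect (exists p, monic_irreducible_poly p /\ size p = d.+1).
    by exists p.
  by exists 0 => p' h1 h2; case: hp; exists p'.
by have [P hP] := choice h; exists P.
Qed.

(** The matrix [compmx (d * k) (P d ^+ k)] depends only on the type [(d, k)] of the
    block, not on [x] or on the irreducible polynomial that belongs to the block. *)
Lemma adapted_summand P n (x : 'M[F]_n.+1) d k V : irreducible_family P ->
    primary_summand x 1%:M (d, k, V) ->
  (block_weight d k * #|unit_mxs F (n.+1 - d * k)| <=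
   #|[set AB in adapted (n.+1 - d * k) (compmx (d * k) (P d ^+ k)) x | <<AB.1>>%MS == V]|)%N.
Proof.
move=> hP [p' [K [W [[irp' mp' sp' k0] [[Kf Kx ->] [Wx VW rW]]]]]].
have d0 : (0 < d)%N by case: irp'; rewrite sp' ltnS.
have p'I : monic_irreducible_poly p' by [].
have [pI sp] := hP d p' p'I sp'.
have dk0 : (0 < d * k)%N by rewrite muln_gt0 d0.
have rK : \rank K = (d * k)%N by apply/eqP.
have le_dk : (d * k <= n.+1)%N by rewrite -rK rank_leq_col.
have {}rW : \rank W = (n.+1 - d * k)%N.
  apply/eqP; rewrite eqn_leq; rewrite mxrank1 in rW; rewrite rW /= leq_subLR.
  have := mxrank_adds_leqif <<K>>%MS W; rewrite VW mxrank1 mxrank_gen rK.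
  by case.
have [B [Bf BW]] : exists B : 'M[F]_(n.+1 - d * k, n.+1), row_free B /\ (B :=: W)%MS.
  move: (row_base W) (row_base_free W) (eq_row_base W); rewrite rW => B Bf BW.
  by exists B.
have KBf : row_free (col_mx K B).
  rewrite /row_free -addsmxE (adds_eqmx (eqmx_sym (genmxE K)) BW) VW mxrank1.
  by rewrite subnKC.
have Bx : stablemx B x by rewrite (eqmx_stable x BW).
apply: leq_trans (_ : #|coprime_rV (P d) (d * k)| * #|lift_rV (P d) p' k (d * k)| *
    #|unit_mxs F (n.+1 - d * k)| <= _)%N.
  by rewrite leq_mul2r block_weight_le ?orbT.
have sN := size_exp_monic k pI.2 sp; have sN' := size_exp_monic k mp' sp'.
case: (d * k)%N dk0 K Kf {rK rW VW le_dk} Kx B {Bf BW} KBf Bx sN sN' => // N _ K Kf Kx B KBf Bx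
  sN sN'.
exact: card_adapted_block pI.1 pI.2 sN k0 irp' mp' sN' KBf Kx Bx.
Qed.

(** Different blocks of [x] of the same type contribute disjoint sets of adapted
    pairs, distinguished by the row space of [A]. *)
Lemma card_adapted_ge P n (x : 'M[F]_n.+1) (L : seq (nat * nat * 'M[F]_n.+1)) d k :
    irreducible_family P -> (forall b, b \in L -> primary_summand x 1%:M b) ->
    uniq (map snd L) ->
  (count (fun b => b.1 == (d, k)) L * (block_weight d k * #|unit_mxs F (n.+1 - d * k)|) <=
   #|adapted (n.+1 - d * k) (compmx (d * k) (P d ^+ k)) x|)%N.
Proof.
move=> hP LP uL; set A := adapted _ _ _.
pose L' := [seq b <- L | b.1 == (d, k)].
have uL' : uniq (map snd L').
  by apply: subseq_uniq uL; apply/map_subseq/filter_subseq.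
apply: leq_trans (sum_card_fibers A (fun AB => <<AB.1>>%MS) uL').
rewrite big_map -size_filter -/L' -sum1_size big_distrl /=.
rewrite big_seq [X in (_ <= X)%N]big_seq; apply: leq_sum => -[dk V].
rewrite mem_filter mul1n /= => /andP[/eqP-> /LP]; exact: adapted_summand.
Qed.

Lemma card_row_free_pairs N M n : (N + M = n)%N ->
  #|[set AB : 'M[F]_(N, n) * 'M[F]_(M, n) | row_free (col_mx AB.1 AB.2)]| = #|unit_mxs F n|.
Proof.
move=> <-.
have hi : injective (fun AB : 'M[F]_(N, N + M) * 'M[F]_(M, N + M) => col_mx AB.1 AB.2).
  by move=> [A B] [A' B'] /= /eq_col_mx[-> ->].
rewrite -(card_imset _ hi); apply: eq_card => g; rewrite inE.
apply/imsetP/idP => [[AB] | gu]; first by rewrite inE -row_free_unit => ABf ->.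
by exists (usubmx g, dsubmx g); rewrite ?inE /= vsubmxK // row_free_unit.
Qed.

(** A set of invertible, pairwise non-commuting matrices. *)
Definition ncset n (X : {set 'M[F]_n}) : bool :=
  [forall x in X, x \in unitmx] &&
  [forall x in X, forall y in X, (x != y) ==> (x *m y != y *m x)].

(** The maximal cardinality of such a set of [n x n] matrices, in any dimension [n
    >= 0]. *)
Definition ncmax n : nat := \max_(X : {set 'M[F]_n} | ncset X) #|X|.

Lemma ncmax_ge n (X : {set 'M[F]_n}) : ncset X -> (#|X| <= ncmax n)%N.
Proof. exact: (@leq_bigmax_cond _ (@ncset n) (fun Z : {set 'M[F]_n} => #|Z|)). Qed.

Lemma ncsetP n (X : {set 'M[F]_n}) :
  reflect ((forall x, x \in X -> x \in unitmx) /\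
           (forall x y, x \in X -> y \in X -> x *m y = y *m x -> x = y)) (ncset X).
Proof.
apply: (iffP andP) => [[/forall_inP Xu /forall_inP Xc]|[Xu Xc]]; split=> //.
- move=> x y xX yX xy; apply/eqP/negPn/negP => nxy.
  by have /forall_inP/(_ y yX)/implyP/(_ nxy)/eqP := Xc x xX.
- exact/forall_inP.
apply/forall_inP => x xX; apply/forall_inP => y yX; apply/implyP => nxy.
by apply: contra nxy => /eqP xy; apply/eqP/Xc.
Qed.

Lemma comm_compmx2 N f (z z' : 'M[F]_N) :
  z *m compmx N f = compmx N f *m z -> z' *m compmx N f = compmx N f *m z' ->
  z *m z' = z' *m z.
Proof.
case: N z z' => [|N] z z' zC z'C; first by rewrite [LHS]flatmx0 [RHS]flatmx0.
by rewrite (comm_compmx zC) (comm_compmx z'C); apply: comm_horner_mx2.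
Qed.

(** For a pair [(A, B)], the members of a non-commuting set to which it is adapted
    commute on the rows of [A], since they act there through the commutative
    centralizer of a companion matrix. Hence their restrictions to the row space of
    [B] do not commute. *)
Lemma card_adapted_fiber n N M f (X : {set 'M[F]_n})
    (AB : 'M[F]_(N, n) * 'M[F]_(M, n)) :
    ncset X -> (N + M = n)%N ->
  (#|[set x in X | AB \in adapted M (compmx N f) x]| <= ncmax M)%N.
Proof.
move=> /ncsetP[Xu Xc] NM; case: AB => A B; set Y := [set x in X | _].
(* The matrix of the restriction of [x] to the row space of [B]. *)
pose h (x : 'M[F]_n) := B *m x *m pinvmx B.
have hP x : x \in Y -> [/\ x \in X, row_free (col_mx A B), h x *m B = B *m x &
    exists2 z, z *m compmx N f = compmx N f *m z & A *m x = z *m A].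
  rewrite !inE => /andP[xX /and3P[/= ABf Bx /existsP[z /andP[/eqP zC /eqP Ax]]]].
  by split=> //; [rewrite mulmxKpV | exists z].
have hc x y : x \in Y -> y \in Y -> h x *m h y = h y *m h x -> x = y.
  move=> /hP[xX ABf hx [z zC Ax]] /hP[yX _ hy [z' z'C Ay]] hxy; apply: Xc => //.
  have ABfull : row_full (col_mx A B) by rewrite /row_full (eqP ABf) NM.
  apply: (row_full_inj ABfull); rewrite !mul_col_mx; congr col_mx.
    by rewrite !mulmxA Ax Ay -!mulmxA Ax Ay !mulmxA (comm_compmx2 zC z'C).
  have hB u v : h u *m B = B *m u -> h v *m B = B *m v -> B *m (u *m v) = h u *m h v *m B.
    by move=> hu hv; rewrite -[RHS]mulmxA hv [RHS]mulmxA hu mulmxA.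
  by rewrite (hB x y) // (hB y x) // hxy.
have hi : {in Y &, injective h} by move=> x y xY yY e; apply: hc; rewrite // e.
rewrite -(card_in_imset hi); apply: ncmax_ge.
apply/ncsetP; split=> [_ /imsetP[x xY ->] | _ _ /imsetP[x xY ->] /imsetP[y yY ->] e].
  have [xX ABf hx _] := hP x xY.
  rewrite -row_free_unit; apply: inj_row_free => u ux.
  have Bf := row_free_col_mxr ABf.
  apply/eqP; rewrite -(mulmx_free_eq0 _ Bf) -(mulmx_free_eq0 _ (_ : row_free x)) ?row_free_unit
    ?Xu //.
  by rewrite -mulmxA -hx mulmxA ux mul0mx.
by rewrite (hc x y).
Qed.

Lemma sum_card_adapted n N M f (X : {set 'M[F]_n}) : ncset X -> (N + M = n)%N ->
  (\sum_(x in X) #|adapted M (compmx N f) x| <= #|unit_mxs F n| * ncmax M)%N.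
Proof.
move=> ncX NM; rewrite -(card_row_free_pairs NM) -sum_nat_const.
under eq_bigr do rewrite -sum1_card.
rewrite (exchange_big_dep (fun AB : 'M[F]_(N, n) * 'M[F]_(M, n) => row_free (col_mx AB.1 AB.2)))
  /=; last first.
  by move=> x AB _; rewrite inE => /and3P[].
under [X in (_ <= X)%N]eq_bigl do rewrite inE.
apply: leq_sum => AB _; apply: leq_trans (card_adapted_fiber f AB ncX NM).
by rewrite -sum1_card; apply/eq_leq/eq_bigl => x; rewrite inE.
Qed.

End Recursion.

(** * A recursive bound for the density of non-commuting sets *)

Section RealRecursion.
Variables (R : realFieldType) (F : finFieldType).
Local Notation q := #|F|.

(** The types [(d, k)] of blocks of dimension at most [n]. *)
Definition block_types n : seq (nat * nat) :=
  [seq t <- [seq (d, k) | d <- iota 1 n, k <- iota 1 n] | t.1 * t.2 <= n]%N.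

Lemma mem_block_types n d k :
  ((d, k) \in block_types n) = [&& 0 < d, 0 < k & d * k <= n]%N.
Proof.
rewrite mem_filter /= andbC; apply/andP/and3P => [[/allpairsP[[a b] /= [+ + [-> ->]]]]|[d0 k0 le]].
  by rewrite !mem_iota => /andP[-> _] /andP[-> _].
split=> //; apply/allpairsP; exists (d, k); rewrite /= !mem_iota add1n !ltnS d0 k0 /=; split=> //.
  by apply: leq_trans le; rewrite leq_pmulr.
by apply: leq_trans le; rewrite leq_pmull.
Qed.

Lemma block_types_uniq n : uniq (block_types n).
Proof.
by apply/filter_uniq/allpairs_uniq; rewrite ?iota_uniq // => -[a b] [a' b'].
Qed.

Lemma sum_count (T : eqType) (I : eqType) (L : seq T) (s : seq I) (f : T -> I) (w : I -> nat) :
    uniq s -> (forall b, b \in L -> f b \in s) ->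
  (\sum_(b <- L) w (f b) = \sum_(i <- s) w i * count (fun b => f b == i) L)%N.
Proof.
move=> us; elim: L => [|b L IH] Ls.
  by rewrite big_nil big1 // => i _; rewrite muln0.
rewrite big_cons IH; last by move=> c cL; apply: Ls; rewrite inE cL orbT.
under [RHS]eq_bigr do rewrite /= mulnDr.
rewrite big_split /=; congr (_ + _)%N.
rewrite (bigD1_seq (f b)) ?Ls ?mem_head //= eqxx muln1 big1 ?addn0 // => i.
by rewrite eq_sym => /negPf->; rewrite muln0.
Qed.

(** The maximal size of a non-commuting set of invertible matrices relative to the
    number of invertible matrices. *)
Definition ncdens n : R := (ncmax F n)%:R / #|unit_mxs F n|%:R.

Lemma unit_mxs_gt0 n : (0 < #|unit_mxs F n|)%N.
Proof. by apply/card_gt0P; exists 1%:M; rewrite inE unitmx1. Qed.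

Lemma ncmax_attained n : exists2 X : {set 'M[F]_n}, ncset X & #|X| = ncmax F n.
Proof.
have : (0 < #|[pred X : {set 'M[F]_n} | ncset X]|)%N.
  apply/card_gt0P; exists finset.set0; apply/ncsetP; split=> [x|x y]; by rewrite inE.
by move=> /(eq_bigmax_cond (fun X : {set 'M[F]_n} => #|X|))[X ncX e]; exists X.
Qed.

(** The blocks of every [x] have total dimension [n.+1]. Summing the dimensions over
    all blocks of all members of a maximal non-commuting set [X], and bounding the
    number of blocks of each type by counting adapted pairs, gives the inequality.
    The range [block_types m] of the sum does not depend on [n], for [n < m]. *)
Lemma ncdens_recursion n m : (n.+1 <= m)%N ->
  n.+1%:R * ncdens n.+1 <=
  \sum_(t <- block_types m | (t.1 * t.2 <= n.+1)%N)
     (t.1 * t.2)%:R / (block_weight F t.1 t.2)%:R * ncdens (n.+1 - t.1 * t.2).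
Proof.
move=> lenm; have [X ncX cX] := ncmax_attained n.+1.
have [P hP] := irreducible_family_ex F.
have [L hL] := choice (@primary_decomposition F n).
set s := [seq t <- block_types m | (t.1 * t.2 <= n.+1)%N].
have us : uniq s by rewrite filter_uniq ?block_types_uniq.
have Ls x b : b \in L x -> b.1 \in s.
  have [LP uL sL] := hL x; case: b => -[d k] V bL; rewrite mem_filter mem_block_types /=.
  have le : (d * k <= n.+1)%N.
    by rewrite -sL (big_rem _ bL) /= leq_addr.
  have [p' [K [W [[irp' mp' sp' k0] _]]]] := LP _ bL.
  by rewrite le k0 (leq_trans le lenm) andbT; case: irp'; rewrite sp' ltnS => ->.
have key : (n.+1 * #|X| <= \sum_(t <- s) (t.1 * t.2) *
    \sum_(x in X) count (fun b => b.1 == t) (L x))%N.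
  under eq_bigr do rewrite big_distrr /=.
  rewrite exchange_big /= mulnC -sum_nat_const; apply: leq_sum => x _.
  have [LP uL sL] := hL x; rewrite -[X in (X <= _)%N]sL.
  by rewrite (@sum_count _ _ _ s fst (fun t => t.1 * t.2)%N us) // => b; apply: Ls.
have key2 t : t \in s -> ((\sum_(x in X) count (fun b => b.1 == t) (L x)) *
    (block_weight F t.1 t.2 * #|unit_mxs F (n.+1 - t.1 * t.2)|) <=
    #|unit_mxs F n.+1| * ncmax F (n.+1 - t.1 * t.2))%N.
  case: t => d k; rewrite mem_filter => /andP[/= le _].
  apply: leq_trans (sum_card_adapted (P d ^+ k) ncX (subnKC le)).
  rewrite big_distrl; apply: leq_sum => x _ /=; have [LP uL _] := hL x.
  exact: card_adapted_ge.
rewrite -big_filter -/s /ncdens mulrA -cX -natrM.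
rewrite ler_pdivrMr ?ltr0n ?unit_mxs_gt0 // mulr_suml.
apply: (@le_trans _ _ (\sum_(t <- s) (t.1 * t.2) *
    \sum_(x in X) count (fun b => b.1 == t) (L x))%:R); first by rewrite ler_nat.
rewrite natr_sum big_seq [leRHS]big_seq; apply: ler_sum => t ts.
rewrite natrM -!mulrA ler_wpM2l ?ler0n //.
have [d0] : (0 < t.1)%N.
  by move: ts; case: t => d k; rewrite mem_filter mem_block_types => /and4P[].
have := block_weight_gt0 F t.2 d0; have := unit_mxs_gt0 (n.+1 - t.1 * t.2).
move: (key2 t ts); move: (block_weight F t.1 t.2) #|unit_mxs F (n.+1 - _)| => D g'.
move=> k2 g0 D0; move: k2; rewrite -(ler_nat R) !natrM => k2.
have D0' : D%:R != 0 :> R by rewrite pnatr_eq0 -lt0n.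
have g0' : g'%:R != 0 :> R by rewrite pnatr_eq0 -lt0n.
set S := (\sum_(x in X) _)%N in k2 *; set W := (ncmax F _)%:R in k2 *.
set g := #|unit_mxs F n.+1|%:R in k2 *.
have -> : D%:R^-1 * (W * (g'%:R^-1 * g)) = (g * W) / (D%:R * g'%:R).
  by field; rewrite D0' g0'.
by rewrite ler_pdivlMr // mulr_gt0 // ltr0n.
Qed.
End RealRecursion.

(** * Coefficients of exponential generating functions *)

Section TruncatedExponential.
Variable R : realFieldType.
Implicit Types L : seq (nat * R).

(** The coefficient of [v^n] in [(1 - v)^-1 exp (\sum w v^N)], where the sum ranges
    over the entries [(N, w)] of the list [L], and each [N] is positive. *)
Fixpoint expcoef L (n : nat) : R :=
  if L is (N, w) :: L' then
    \sum_(j < n.+1 | (j * N <= n)%N) w ^+ j / j`!%:R * expcoef L' (n - j * N)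
  else 1.

Arguments expcoef : simpl never.

Lemma expcoef_cons N w L n M : (0 < N)%N -> (n < M)%N ->
  expcoef ((N, w) :: L) n =
  \sum_(0 <= j < M | (j * N <= n)%N) w ^+ j / j`!%:R * expcoef L (n - j * N).
Proof.
move=> N0 nM; rewrite /expcoef -/expcoef (big_cat_nat _ (n := n.+1)) //= big_mkord.
rewrite [X in _ + X]big_nat_cond [X in _ + X]big_pred0 ?addr0 // => j.
apply/negbTE/negP => /andP[/andP[nj _] jN].
by move: (leq_trans nj (leq_trans (leq_pmulr j N0) jN)); rewrite ltnn.
Qed.

Lemma expcoef_ge0 L n : (forall t, t \in L -> 0 <= t.2) -> 0 <= expcoef L n.
Proof.
elim: L n => [|[N w] L IH] n Lw; first exact: ler01.
rewrite /expcoef -/expcoef; apply: sumr_ge0 => j _.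
have w0 : 0 <= w by apply: (Lw (N, w)); rewrite mem_head.
rewrite mulr_ge0 ?divr_ge0 ?exprn_ge0 ?ler0n // IH // => t tL.
by apply: Lw; rewrite inE tL orbT.
Qed.

(** The contribution of the first factor to [v d/dv] of the product. *)
Lemma expcoef_head N w L n : (0 < N)%N ->
  \sum_(0 <= j < n.+1 | (j * N <= n)%N)
     (j * N)%:R * (w ^+ j / j`!%:R * expcoef L (n - j * N)) =
  if (N <= n)%N then N%:R * w * expcoef ((N, w) :: L) (n - N) else 0.
Proof.
move=> N0; rewrite big_mkcond big_nat_recl //= mul0n mul0r add0r.
case: leqP => [leNn|ltnN]; last first.
  rewrite big1 // => j _; case: ifP => // le.
  by move: (leq_trans ltnN (leq_trans (leq_pmull N (ltn0Sn j)) le)); rewrite ltnn.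
rewrite (expcoef_cons w L N0 (_ : n - N < n)%N); last first.
  by rewrite ltn_subrL N0 (leq_trans N0).
rewrite [in RHS]big_mkcond mulr_sumr /=; apply: eq_bigr => j _.
rewrite leq_subRL // mulSn; case: ifP => le; last by rewrite mulr0.
rewrite subnDA exprS factS !natrM.
have f0 : j`!%:R != 0 :> R by rewrite pnatr_eq0 -lt0n fact_gt0.
have s0 : j%:R + 1 != 0 :> R by rewrite natr1 pnatr_eq0.
by rewrite -mulSn natrM -natr1; field; rewrite f0 s0.
Qed.

(** Coefficient form of the logarithmic derivative [v f' = f (v / (1 - v) + \sum N w
    v^N)]. *)
Lemma expcoef_recursion L n : (forall t, t \in L -> (0 < t.1)%N) ->
  n%:R * expcoef L n = \sum_(0 <= i < n) expcoef L i +
    \sum_(t <- L | (t.1 <= n)%N) t.1%:R * t.2 * expcoef L (n - t.1).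
Proof.
elim: L n => [|[N w] L IH] n LN.
  rewrite big_nil addr0 [RHS](eq_bigr (fun=> 1)) // sumr_const_nat subn0.
  exact: mulr1.
have N0 : (0 < N)%N by apply: (LN (N, w)); rewrite mem_head.
have {}LN t : t \in L -> (0 < t.1)%N by move=> tL; apply: LN; rewrite inE tL orbT.
have {}IH m := IH m LN.
rewrite (expcoef_cons w L N0 (ltnSn n)) mulr_sumr.
have -> : \sum_(0 <= j < n.+1 | (j * N <= n)%N) n%:R * (w ^+ j / j`!%:R * expcoef L (n - j * N))
  = \sum_(0 <= j < n.+1 | (j * N <= n)%N) (j * N)%:R * (w ^+ j / j`!%:R * expcoef L (n - j * N))
  + \sum_(0 <= j < n.+1 | (j * N <= n)%N) w ^+ j / j`!%:R * ((n - j * N)%:R * expcoef L (n - j *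
    N)).
  rewrite -big_split; apply: eq_bigr => j le /=.
  by rewrite -{1}(subnKC le) natrD; ring.
rewrite expcoef_head // [X in _ = _ + X]big_mkcond big_cons -big_mkcond.
rewrite -[(N, w).1]/N -[(N, w).2]/w; set H := if _ then _ else _.
pose c j := w ^+ j / j`!%:R.
rewrite [X in _ + X](eq_bigr (fun j => c j * (\sum_(0 <= i < n - j * N) expcoef L i) +
  c j * (\sum_(t <- L | (t.1 <= n - j * N)%N) t.1%:R * t.2 * expcoef L (n - j * N - t.1))));
    last first.
  by move=> j _; rewrite IH mulrDr.
rewrite big_split {}/c.
have -> : \sum_(0 <= i < n) expcoef ((N, w) :: L) i =
  \sum_(0 <= j < n.+1 | (j * N <= n)%N) w ^+ j / j`!%:R * \sum_(0 <= i < n - j * N) expcoef L i.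
  transitivity (\sum_(0 <= i < n) \sum_(0 <= j < n.+1 | (j * N <= i)%N) w ^+ j / j`!%:R *
    expcoef L (i - j * N)).
    rewrite big_nat [RHS]big_nat; apply: eq_bigr => i /andP[_ lin].
    by rewrite (@expcoef_cons _ _ _ _ n.+1) // ltnW.
  rewrite (exchange_big_dep_nat (fun j => (j * N <= n)%N)) /=; last first.
    by move=> i j h1 h2 h3 h4; move: h1 h2 h3 h4; lia.
  apply: eq_bigr => j le; rewrite mulr_sumr.
  rewrite (big_cat_nat _ (n := (j * N)%N)) //= [X in X + _]big_nat_cond big_pred0 ?add0r;
    last first.
    by move=> i; rewrite /= andbC; case: ltnP => //=; rewrite ltnNge => /negbTE->.
  rewrite -{1}[(j * N)%N]add0n big_addn; apply: eq_big => i.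
    by rewrite leq_addl.
  by rewrite addnK.
have -> : \sum_(t <- L | (t.1 <= n)%N) t.1%:R * t.2 * expcoef ((N, w) :: L) (n - t.1) =
  \sum_(0 <= j < n.+1 | (j * N <= n)%N) w ^+ j / j`!%:R *
     \sum_(t <- L | (t.1 <= n - j * N)%N) t.1%:R * t.2 * expcoef L (n - j * N - t.1).
  transitivity (\sum_(t <- L | (t.1 <= n)%N) \sum_(0 <= j < n.+1 | (j * N <= n - t.1)%N)
      t.1%:R * t.2 * (w ^+ j / j`!%:R * expcoef L (n - t.1 - j * N))).
    apply: eq_bigr => t le; rewrite (@expcoef_cons _ _ _ _ n.+1) ?ltnS ?leq_subr //.
    by rewrite mulr_sumr.
  rewrite (exchange_big_dep (fun j => (j * N <= n)%N)) /=; last first.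
    by move=> t j _ /leq_trans; apply; apply: leq_subr.
  apply: eq_bigr => j le; rewrite mulr_sumr; apply: eq_big => [t|t _].
    by apply/andP/idP => [[h1 h2]|h]; [|split]; lia.
  by rewrite subnAC; ring.
by rewrite [LHS]addrCA.
Qed.

(** A sequence that satisfies the recursion as an inequality is bounded by the
    coefficients. *)
Lemma expcoef_pointwise L n (b : nat -> R) :
    (forall t, t \in L -> (0 < t.1)%N) -> (forall t, t \in L -> 0 <= t.2) -> b 0%N <= 1 ->
    (forall m, (0 < m <= n)%N -> m%:R * b m <= \sum_(0 <= i < m) b i +
      \sum_(t <- L | (t.1 <= m)%N) t.1%:R * t.2 * b (m - t.1)%N) ->
  b n <= expcoef L n.
Proof.
move=> LN Lw b0 bn; move: (leqnn n); elim/ltn_ind: {-2}n => -[_|m IH] lemn.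
  apply: le_trans b0 _; elim: L {LN bn} Lw => [|[N w] L IHL] Lw; first exact: lexx.
  rewrite /expcoef -/expcoef (bigD1 ord0) //= expr0 fact0 invr1 !mul1r subn0.
  have {}IHL : 1 <= expcoef L 0 by apply: IHL => t tL; apply: Lw; rewrite inE tL orbT.
  rewrite -[leLHS]addr0; apply: lerD => //; apply: sumr_ge0 => j _.
  have w0 : 0 <= w by apply: (Lw (N, w)); rewrite mem_head.
  rewrite mulr_ge0 ?divr_ge0 ?exprn_ge0 ?ler0n // expcoef_ge0 // => t tL.
  by apply: Lw; rewrite inE tL orbT.
rewrite -(ler_pM2l (ltr0Sn R m)) expcoef_recursion //.
apply: le_trans (bn m.+1 lemn) _; apply: lerD.
  by rewrite big_nat [leRHS]big_nat; apply: ler_sum => i /andP[_ lim]; apply: IH => //;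
    apply: leq_trans lemn; apply: ltnW.
rewrite big_seq_cond [leRHS]big_seq_cond; apply: ler_sum => t /andP[tL le].
rewrite ler_wpM2l ?mulr_ge0 ?ler0n ?Lw // IH //.
  by rewrite ltn_subrL LN.
by rewrite (leq_trans (leq_subr _ _)).
Qed.
End TruncatedExponential.

(** * Partial products and the tail estimate *)

Section EulerProduct.
Variable R : realFieldType.
Implicit Types x y : R.

(** The exponent [k (k + 1) / 2 + 1] of the [k]-th factor. The product [k * k.+1] is
    even, so that halving is exact. *)
Definition pexpo k : nat := ((k * k.+1)./2 + 1)%N.

(** The partial products as functions of [x = 1/q]. *)
Definition eulerprod x m : R := \prod_(1 <= k < m.+1) (1 - x ^+ k) ^- pexpo k.

Lemma pexpoS k : pexpo k.+1 = (pexpo k + k.+1)%N.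
Proof.
rewrite /pexpo -[RHS]addnAC; congr (_ + 1)%N.
have -> : (k.+1 * k.+2 = k * k.+1 + (k.+1).*2)%N by rewrite -mul2n; lia.
by rewrite halfD odd_double andbF add0n doubleK.
Qed.

Lemma pexpo_ge k : (k <= pexpo k)%N.
Proof. by elim: k => // k IH; rewrite pexpoS -addn1 leq_add // /pexpo addn1. Qed.

Lemma eulerprodS x m : eulerprod x m.+1 = eulerprod x m * (1 - x ^+ m.+1) ^- pexpo m.+1.
Proof. by rewrite /eulerprod big_nat_recr. Qed.

Lemma one_sub_expr_itv x k : 0 <= x < 1 -> (0 < k)%N -> 0 < 1 - x ^+ k <= 1.
Proof.
move=> /andP[x0 x1] k0; rewrite subr_gt0 expr_lt1 //= x1 lerBlDr lerDl.
exact: exprn_ge0.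
Qed.

Lemma factor_ge1 x k e : 0 <= x < 1 -> (0 < k)%N -> 1 <= (1 - x ^+ k) ^- e.
Proof.
move=> hx k0; have /andP[h0 h1] := one_sub_expr_itv hx k0.
by rewrite invf_ge1 ?exprn_gt0 // exprn_ile1 // ltW.
Qed.

Lemma eulerprod_ge1 x m : 0 <= x < 1 -> 1 <= eulerprod x m.
Proof.
move=> hx; elim: m => [|m IH]; first by rewrite /eulerprod big_nil.
by rewrite eulerprodS -[leLHS]mulr1 ler_pM ?ler01 // factor_ge1.
Qed.

Lemma eulerprod_nondecreasing x m m' : 0 <= x < 1 -> (m <= m')%N ->
  eulerprod x m <= eulerprod x m'.
Proof.
move=> hx; elim: m' => [|m' IH]; first by rewrite leqn0 => /eqP->.
rewrite leq_eqVlt => /predU1P[-> //|]; rewrite ltnS => /IH le.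
apply: le_trans le _; rewrite eulerprodS ler_peMr ?factor_ge1 //.
by rewrite (le_trans ler01) ?eulerprod_ge1.
Qed.

Lemma eulerprod_le x y m : 0 <= x <= y -> y < 1 -> eulerprod x m <= eulerprod y m.
Proof.
move=> /andP[x0 xy] y1; have y0 := le_trans x0 xy; have x1 := le_lt_trans xy y1.
have hx : 0 <= x < 1 by rewrite x0.
have hy : 0 <= y < 1 by rewrite y0.
elim: m => [|m IH]; first by rewrite /eulerprod !big_nil.
rewrite !eulerprodS ler_pM //.
- exact: le_trans ler01 (eulerprod_ge1 _ hx).
- by apply: le_trans ler01 (factor_ge1 _ hx _).
have /andP[hx' _] := one_sub_expr_itv hx (ltn0Sn m).
have /andP[hy' _] := one_sub_expr_itv hy (ltn0Sn m).
rewrite lef_pV2 ?posrE ?exprn_gt0 //.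
apply: lerXn2r; rewrite ?nnegrE ?(ltW hx') ?(ltW hy') //.
by apply: lerB => //; apply: lerXn2r; rewrite ?nnegrE.
Qed.

Lemma bernoulli_le (a : R) n : -1 <= a -> 1 + n%:R * a <= (1 + a) ^+ n.
Proof.
move=> a1; elim: n => [|n IH]; first by rewrite mul0r addr0 expr0.
have h : 0 <= 1 + a by lra.
rewrite exprS; apply: le_trans (ler_wpM2l h IH); rewrite -natr1.
have : 0 <= n%:R * (a * a) by rewrite mulr_ge0 ?ler0n // -expr2 sqr_ge0.
by lra.
Qed.

(** The generating function of the exponents is [y / (1 - y) + y / (1 - y)^3]; the
    subtracted term is the tail of the series, in closed form. *)
Lemma pexpo_sum y m : y != 1 ->
  \sum_(1 <= k < m.+1) (pexpo k)%:R * y ^+ k =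
  y / (1 - y) + y / (1 - y) ^+ 3 -
  y ^+ m.+1 * (1 + (1 - y) * m%:R + (1 - y) ^+ 2 * (pexpo m)%:R) / (1 - y) ^+ 3.
Proof.
move=> y1; have h : 1 - y != 0 by rewrite subr_eq0 eq_sym.
elim: m => [|m IH]; first by rewrite big_nil /pexpo /=; field.
by rewrite big_nat_recr //= IH pexpoS natrD -natr1 !exprS; field.
Qed.

Lemma pexpo_sum_le y m : 0 <= y < 1 ->
  \sum_(1 <= k < m.+1) (pexpo k)%:R * y ^+ k <= y / (1 - y) + y / (1 - y) ^+ 3.
Proof.
move=> /andP[y0 y1]; rewrite pexpo_sum ?lt_eqF // gerBl.
have h : 0 <= 1 - y by rewrite subr_ge0 ltW.
apply: divr_ge0; last exact: exprn_ge0.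
apply: mulr_ge0; first exact: exprn_ge0.
apply: addr_ge0; last by rewrite mulr_ge0 ?exprn_ge0.
by apply: addr_ge0 => //; apply: mulr_ge0.
Qed.

(** The sum of [pexpo k * y ^+ k] over [k > K]. *)
Definition pexpo_tail y K : R :=
  y ^+ K.+1 * (1 + (1 - y) * K%:R + (1 - y) ^+ 2 * (pexpo K)%:R) / (1 - y) ^+ 3.

(** The factors beyond [K] contribute at most [1 / (1 - tail)]: the product of [(1 -
    y^k)^(pexpo k)] is at least one minus the sum of [pexpo k y^k]. *)
Lemma eulerprod_tail y K m : 0 <= y < 1 -> pexpo_tail y K < 1 ->
  eulerprod y m <= eulerprod y K / (1 - pexpo_tail y K).
Proof.
move=> hy tau1; have /andP[y0 y1] := hy.
pose S j := \sum_(K.+1 <= k < K.+1 + j) (pexpo k)%:R * y ^+ k.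
pose P j := \prod_(K.+1 <= k < K.+1 + j) (1 - y ^+ k) ^+ pexpo k.
have Stau j : S j <= pexpo_tail y K.
  have := @pexpo_sum_le y (K + j) hy.
  rewrite (big_cat_nat _ (n := K.+1)) //= ?ltnS ?leq_addr // -addSn -/(S j).
  by rewrite pexpo_sum ?lt_eqF // -/(pexpo_tail y K); lra.
have P01 j : 0 < P j <= 1.
  rewrite /P; elim: j => [|j /andP[IH0 IH1]]; first by rewrite addn0 big_geq // lexx ltr01.
  rewrite addnS big_nat_recr ?leq_addr //=.
  have /andP[h0 h1] := @one_sub_expr_itv y (K.+1 + j) hy isT.
  by rewrite mulr_gt0 ?exprn_gt0 //= mulr_ile1 ?exprn_ile1 ?exprn_ge0 // ltW.
(* The Weierstrass inequality, by Bernoulli's inequality for each factor. *)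
have PS j : 1 - S j <= P j.
  elim: j => [|j IH]; first by rewrite /P /S addn0 !big_geq // subr0.
  have -> : S j.+1 = S j + (pexpo (K.+1 + j))%:R * y ^+ (K.+1 + j).
    by rewrite /S addnS big_nat_recr ?leq_addr.
  have -> : P j.+1 = P j * (1 - y ^+ (K.+1 + j)) ^+ pexpo (K.+1 + j).
    by rewrite /P addnS big_nat_recr ?leq_addr.
  have /andP[P0 P1] := P01 j.
  have y01 : 0 <= y ^+ (K.+1 + j) <= 1 by rewrite exprn_ge0 // exprn_ile1 // ltW.
  have bern : 1 - (pexpo (K.+1 + j))%:R * y ^+ (K.+1 + j) <=
      (1 - y ^+ (K.+1 + j)) ^+ pexpo (K.+1 + j).
    by rewrite -mulrN; apply: bernoulli_le; lra.
  set e := _%:R * _ in bern *; have e0 : 0 <= e by rewrite mulr_ge0 ?ler0n ?(andP y01).1.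
  have h1 := ler_wpM2l (ltW P0) bern; have h2 : P j * e <= e by rewrite ler_piMl.
  by move: h1; rewrite mulrBr mulr1; lra.
have tau0 : 0 < 1 - pexpo_tail y K by rewrite subr_gt0.
have eK0 : 0 <= eulerprod y K by apply: le_trans ler01 (eulerprod_ge1 _ hy).
have [leKm|ltmK] := leqP K m; last first.
  apply: le_trans (eulerprod_nondecreasing hy (ltnW ltmK)) _.
  rewrite ler_pdivlMr // ler_piMr // lerBlDr lerDl.
  by have := Stau 0%N; rewrite /S addn0 big_geq.
have -> : eulerprod y m = eulerprod y K / P (m - K)%N.
  rewrite /eulerprod (big_cat_nat _ (n := K.+1)) //=; congr (_ * _).
  by rewrite /P addSn subnKC // prodfV.
rewrite ler_wpM2l // lef_pV2 ?posrE //; last by case/andP: (P01 (m - K)%N).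
by apply: le_trans (PS _); rewrite lerB.
Qed.
End EulerProduct.

(** * Numerical bounds for the partial products *)

Section NumericBounds.
Variable R : realFieldType.
Implicit Types x y : R.

(** The tail estimate after 7 factors suffices: the tail sum at 1/2 is 47/128, and
    the resulting bound is below 306. *)
Lemma eulerprod_half m : eulerprod (2^-1 : R) m <= 395 + 5 / 10 ^+ 4.
Proof.
have tE : pexpo_tail (2^-1 : R) 7 = 47 / 128.
  by rewrite /pexpo_tail /pexpo /=; field.
apply: le_trans (eulerprod_tail (K := 7) m _ _) _; rewrite ?tE; [lra|lra|].
rewrite /eulerprod; do 7!rewrite big_ltn //; rewrite big_geq //.
have [-> -> -> ->] : [/\ pexpo 1 = 2, pexpo 2 = 4, pexpo 3 = 7 & pexpo 4 = 11]%N by [].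
have [-> -> ->] : [/\ pexpo 5 = 16, pexpo 6 = 22 & pexpo 7 = 29]%N by [].
rewrite -!exprVn.
have -> : (1 - 2^-1 ^+ 1)^-1 = 2 / 1 :> R by field.
have -> : (1 - 2^-1 ^+ 2)^-1 = 4 / 3 :> R by field.
have -> : (1 - 2^-1 ^+ 3)^-1 = 8 / 7 :> R by field.
have -> : (1 - 2^-1 ^+ 4)^-1 = 16 / 15 :> R by field.
have -> : (1 - 2^-1 ^+ 5)^-1 = 32 / 31 :> R by field.
have -> : (1 - 2^-1 ^+ 6)^-1 = 64 / 63 :> R by field.
have -> : (1 - 2^-1 ^+ 7)^-1 = 128 / 127 :> R by field.
rewrite ler_pdivrMr; last by lra.
rewrite !expr_div_n.
lra.
Qed.

(** The value 20/3 is exactly what makes the cubic coefficient 114 at [x = 1/3],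
    since [27 (20/3 - (1 + 2/3 + 7/9)) = 114]. Three factors and the tail estimate
    suffice. *)
Lemma eulerprod_third m : eulerprod (3^-1 : R) m <= 20 / 3.
Proof.
have tE : pexpo_tail (3^-1 : R) 3 = 55 / 216.
  by rewrite /pexpo_tail /pexpo /=; field.
apply: le_trans (eulerprod_tail (K := 3) m _ _) _; rewrite ?tE; [lra|lra|].
rewrite /eulerprod; do 3!rewrite big_ltn //; rewrite big_geq //.
have [-> -> ->] : [/\ pexpo 1 = 2, pexpo 2 = 4 & pexpo 3 = 7]%N by [].
rewrite -!exprVn.
have -> : (1 - 3^-1 ^+ 1)^-1 = 3 / 2 :> R by field.
have -> : (1 - 3^-1 ^+ 2)^-1 = 9 / 8 :> R by field.
have -> : (1 - 3^-1 ^+ 3)^-1 = 27 / 26 :> R by field.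
rewrite ler_pdivrMr; last by lra.
rewrite !expr_div_n.
lra.
Qed.

(** On [[0, r]], the function [f] equals [a + b x + c x^2 + x^3 psi x] with
    nonnegative [a], [b], [c] and a nonnegative nondecreasing [psi]. This replaces a
    power series with nonnegative coefficients. *)
Definition taylor2 (r : R) (f : R -> R) (a b c : R) := [/\ 0 <= a, 0 <= b, 0 <= c &
  exists2 psi : R -> R, forall x y, 0 <= x <= y -> y <= r -> 0 <= psi x <= psi y &
    forall x, 0 <= x <= r -> f x = a + b * x + c * x ^+ 2 + x ^+ 3 * psi x].

Lemma taylor2_mul r f f' a b c a' b' c' :
  taylor2 r f a b c -> taylor2 r f' a' b' c' ->
  taylor2 r (fun x => f x * f' x) (a * a') (a * b' + a' * b) (a * c' + b * b' + a' * c).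
Proof.
move=> [a0 b0 c0 [psi psiP fE]] [a'0 b'0 c'0 [psi' psi'P f'E]].
split; rewrite ?addr_ge0 ?mulr_ge0 //.
pose g x := a' + b' * x + c' * x ^+ 2 + x ^+ 3 * psi' x.
exists (fun x => (b * c' + b' * c) + c * c' * x + psi x * g x
                 + psi' x * (a + b * x + c * x ^+ 2)); last first.
  by move=> x hx; rewrite fE // f'E // /g; ring.
move=> x y hxy yr; have /andP[x0 xy] := hxy; have y0 := le_trans x0 xy.
have /andP[p0 pxy] := psiP _ _ hxy yr; have /andP[p'0 p'xy] := psi'P _ _ hxy yr.
have x2 : x ^+ 2 <= y ^+ 2 by rewrite lerXn2r ?nnegrE.
have x3 : x ^+ 3 <= y ^+ 3 by rewrite lerXn2r ?nnegrE.
have gx0 : 0 <= g x by rewrite !addr_ge0 ?mulr_ge0 ?exprn_ge0.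
have gxy : g x <= g y.
  by rewrite !lerD ?ler_wpM2l // ler_pM ?exprn_ge0.
have qx0 : 0 <= a + b * x + c * x ^+ 2 by rewrite !addr_ge0 ?mulr_ge0 ?exprn_ge0.
have qxy : a + b * x + c * x ^+ 2 <= a + b * y + c * y ^+ 2.
  by rewrite !lerD ?ler_wpM2l.
apply/andP; split; first by rewrite !addr_ge0 ?mulr_ge0.
by rewrite !lerD ?ler_wpM2l ?mulr_ge0 // ler_pM.
Qed.

Lemma taylor2_ext r f f' a b c a' b' c' : taylor2 r f a b c ->
  a = a' -> b = b' -> c = c' -> (forall x, f x = f' x) -> taylor2 r f' a' b' c'.
Proof.
move=> [a0 b0 c0 [psi h1 h2]] <- <- <- ff'; split=> //; exists psi => // x hx.
by rewrite -ff' h2.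
Qed.

Lemma taylor2_geom1 r : r < 1 -> taylor2 r (fun x => (1 - x ^+ 1)^-1) 1 1 1.
Proof.
move=> r1; split; rewrite ?ler01 //;
  exists (fun x => (1 - x)^-1) => [x y /andP[x0 xy] yr|x /andP[x0 xr]].
  by apply/andP; split; [rewrite invr_ge0|rewrite lef_pV2 ?posrE]; lra.
have h : 1 - x != 0 by rewrite gt_eqF //; lra.
by rewrite expr1; field.
Qed.

Lemma taylor2_geom2 r : r < 1 -> taylor2 r (fun x => (1 - x ^+ 2)^-1) 1 0 1.
Proof.
move=> r1; split; rewrite ?ler01 //;
  exists (fun x => x * (1 - x ^+ 2)^-1) => [x y /andP[x0 xy] yr|x /andP[x0 xr]].
  have y1 : y ^+ 2 < 1 by rewrite expr_lt1 //; lra.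
  have x2 : x ^+ 2 <= y ^+ 2 by rewrite lerXn2r ?nnegrE //; lra.
  apply/andP; split; first by apply: mulr_ge0; rewrite ?invr_ge0; lra.
  by apply: ler_pM; rewrite ?invr_ge0 ?lef_pV2 ?posrE; lra.
have h : 1 - x ^+ 2 != 0 by rewrite gt_eqF // subr_gt0 expr_lt1 //; lra.
by field.
Qed.

Lemma taylor2_geom k r : r < 1 -> taylor2 r (fun x => (1 - x ^+ k.+3)^-1) 1 0 0.
Proof.
move=> r1; split; rewrite ?ler01 //.
exists (fun x => x ^+ k * (1 - x ^+ k.+3)^-1) => [x y /andP[x0 xy] yr|x /andP[x0 xr]].
  have y1 : y ^+ k.+3 < 1 by rewrite expr_lt1 //; lra.
  have x2 : x ^+ k.+3 <= y ^+ k.+3 by rewrite lerXn2r ?nnegrE //; lra.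
  have xk : x ^+ k <= y ^+ k by rewrite lerXn2r ?nnegrE //; lra.
  apply/andP; split; first by rewrite mulr_ge0 ?exprn_ge0 ?invr_ge0 //; lra.
  by apply: ler_pM; rewrite ?exprn_ge0 ?invr_ge0 ?lef_pV2 ?posrE //; lra.
have h : 1 - x ^+ k.+3 != 0 by rewrite gt_eqF // subr_gt0 expr_lt1 //; lra.
rewrite mulrA -exprD add3n !mul0r !addr0; move: h; move: (x ^+ _) => u h.
by field.
Qed.

Lemma taylor2_exp0 r f e : taylor2 r f 1 0 0 -> taylor2 r (fun x => f x ^+ e) 1 0 0.
Proof.
move=> hf; elim: e => [|e IH].
  split; rewrite ?ler01 //; exists (fun=> 0) => [x y|x] _ //=; first by rewrite lexx.
  by rewrite expr0; ring.
by apply: taylor2_ext (taylor2_mul hf IH) _ _ _ _ => [|||x]; [ring..|rewrite exprS].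
Qed.

(** From the second on, the partial products all have the same coefficients [1 + 2 x
    + 7 x^2] up to degree 2; from the third factor on, factors are [1] modulo [x^3]. *)
Lemma taylor2_eulerprod r m : r < 1 -> taylor2 r (fun x => eulerprod x m.+2) 1 2 7.
Proof.
move=> r1; elim: m => [|m IH].
  have g1 := taylor2_geom1 r1; have g2 := taylor2_geom2 r1.
  have h2 := taylor2_mul g2 g2; have h4 := taylor2_mul h2 h2.
  apply: taylor2_ext (taylor2_mul (taylor2_mul g1 g1) h4) _ _ _ _ => [|||x]; [ring..|].
  rewrite /eulerprod; do 2!rewrite big_ltn //; rewrite big_geq //.
  have [-> ->] : pexpo 1 = 2%N /\ pexpo 2 = 4%N by [].
  by rewrite -!exprVn; ring.
have h := taylor2_mul IH (taylor2_exp0 (pexpo m.+3) (taylor2_geom m r1)).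
by apply: taylor2_ext h _ _ _ _ => [|||x]; [ring..|rewrite [RHS]eulerprodS exprVn].
Qed.

(** The remainder [psi] is nondecreasing, so that its value at 1/3, which is at most
    114, bounds it on the whole interval. *)
Lemma eulerprod_taylor x m : 0 < x <= 3^-1 ->
  eulerprod x m <= 1 + 2 * x + 7 * x ^+ 2 + 114 * x ^+ 3.
Proof.
move=> /andP[x0 x3]; have hx : 0 <= x < 1 by apply/andP; split; lra.
apply: le_trans (eulerprod_nondecreasing hx (leq_addl 2 m)) _.
have [_ _ _ [psi psiP fE]] : taylor2 3^-1 (fun x => eulerprod x (2 + m)) 1 2 7.
  by apply: taylor2_eulerprod; lra.
have /andP[_ px] := psiP x 3^-1 (introT andP (conj (ltW x0) x3)) (lexx _).
have p3 : psi 3^-1 <= 114.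
  have := fE 3^-1; rewrite lexx andbT => /(_ _)/wrap[]; first by lra.
  by have := eulerprod_third (2 + m); lra.
rewrite fE; last by rewrite (ltW x0).
by rewrite lerD2l mulrC ler_wpM2r ?exprn_ge0 ?(ltW x0) // (le_trans px).
Qed.
End NumericBounds.

(** * Exponential and logarithm *)

Section RealAnalysis.
Variable R : realType.
Implicit Types (x y z w : R) (L : seq (nat * R)).

Lemma exp_partial_le w n : 0 <= w -> \sum_(0 <= j < n) w ^+ j / j`!%:R <= expR w.
Proof.
move=> w0; apply: (nondecreasing_cvgn_le (u_ := series (exp_coeff w)));
  last exact: is_cvg_series_exp_coeff.
by apply: nondecreasing_series => i _ _; exact: exp_coeff_ge0.
Qed.

(** Each factor [exp (w v^N)] is replaced by its value at [v = 1], and truncation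
    only decreases a series with nonnegative terms. *)
Lemma expcoef_le_expR L n : (forall t, t \in L -> 0 <= t.2) ->
  expcoef L n <= expR (\sum_(t <- L) t.2).
Proof.
elim: L n => [|[N w] L IH] n Lw; first by rewrite big_nil expR0.
have w0 : 0 <= w by apply: (Lw (N, w)); rewrite mem_head.
have {}Lw t : t \in L -> 0 <= t.2 by move=> tL; apply: Lw; rewrite inE tL orbT.
rewrite big_cons expRD [expcoef _ _]/expcoef -/expcoef.
apply: le_trans (ler_wpM2r (expR_ge0 _) (exp_partial_le n.+1 w0)).
rewrite mulr_suml big_mkord big_mkcond; apply: ler_sum => j _.
have c0 : 0 <= w ^+ j / j`!%:R by rewrite divr_ge0 ?exprn_ge0.
by case: ifP => _; [rewrite ler_wpM2l ?IH|rewrite mulr_ge0 ?expR_ge0].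
Qed.

(** The partial sums of the series of [- ln (1 - z)] are bounded by it. The
    difference vanishes at 0 and has derivative [- t^n / (1 - t)]. *)
Lemma log_partial_le z n : 0 <= z < 1 ->
  expR (\sum_(0 <= d < n) z ^+ d.+1 / d.+1%:R) <= (1 - z)^-1.
Proof.
move=> /andP[z0 z1].
pose g t : R := \sum_(0 <= d < n) t ^+ d.+1 / d.+1%:R.
pose f (t : R) : R := ln (1 - t) + g t.
have dg (t : R) : is_derive t 1 (g : R -> R) (\sum_(0 <= d < n) t ^+ d).
  rewrite /g; elim: (n) => [|k IH].
    under [X in is_derive _ _ X]eq_fun do rewrite big_geq //.
    by rewrite big_geq //; exact: is_derive_cst.
  under [X in is_derive _ _ X]eq_fun do rewrite big_nat_recr //=.
  rewrite big_nat_recr //=; apply: is_deriveD.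
  have h := @is_deriveZ R R R (id ^+ k.+1) (k.+1%:R^-1) t 1 _
    (@is_deriveX R R id k.+1 t 1 1 (is_derive_id t 1)).
  have -> : (fun t0 : R => t0 ^+ k.+1 / k.+1%:R) = (k.+1%:R^-1 \*: (id ^+ k.+1)).
    by apply/funext => u /=; rewrite exprfctE mulrC.
  apply: is_derive_eq h _.
  by rewrite scaler1 /= -[_ *: _]/(_ * _) mulrA mulVf ?mul1r // pnatr_eq0.
have df (t : R) : t < 1 -> is_derive t 1 f (- (t ^+ n / (1 - t))).
  move=> t1; have t10 : 0 < 1 - t by rewrite subr_gt0.
  have d1 : is_derive t 1 (fun u : R => 1 - u) (0 - 1).
    exact: is_deriveB.
  have d2 := @is_derive1_comp R (@ln R) (fun u : R => 1 - u) t _ _ (is_derive1_ln t10) d1.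
  apply: (is_derive_eq (is_deriveD d2 (dg t))).
  have e : \sum_(0 <= d < n) t ^+ d = (1 - t ^+ n) / (1 - t).
    elim: (n) => [|k IH]; first by rewrite big_geq // expr0 subrr mul0r.
    rewrite big_nat_recr //= IH exprS; field; lra.
  rewrite e; field; lra.
have := @ler0_derive1_le_cc R f 0 z.
have itv u : u \in `[0, z]%R -> u < 1.
  by rewrite in_itv /= => /andP[_ uz]; apply: le_lt_trans z1.
have itvo u : u \in `]0, z[%R -> u < 1.
  by rewrite in_itv /= => /andP[_ uz]; apply: lt_trans z1.
move=> /(_ _ _ _ z 0) h.
have : f z <= f 0.
  apply: h; rewrite ?in_itv /= ?lexx ?z0 //.
  - by move=> u /itvo/df du; apply: ex_derive.
  - move=> u uz; have du := df u (itvo u uz); rewrite derive1E derive_val oppr_le0.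
    move: uz; rewrite in_itv /= => /andP[u0 uz].
    by rewrite divr_ge0 ?exprn_ge0 ?subr_ge0 ?ltW // (lt_trans uz).
  - by apply: derivable_within_continuous => u /itv/df du; apply: ex_derive.
rewrite /f /g subr0 ln1 add0r [X in _ <= X -> _]big1; last first.
  by move=> i _; rewrite expr0n mul0r.
move=> fz; rewrite -[leRHS]lnK ?posrE ?invr_gt0 ?subr_gt0 // ler_expR lnV ?posrE ?subr_gt0 //.
by lra.
Qed.
End RealAnalysis.

(** * Comparison with the infinite product *)

Section UpperBound.
Variable R : realType.
Implicit Types (x y : R).
Local Open Scope classical_set_scope.

(** The sum of the series of [pexpo k * y ^+ k]. *)
Definition loglimit y : R := y / (1 - y) + y / (1 - y) ^+ 3.

(** Convergence to the closed form: the tail is bounded by a constant multiple of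
    the general term. *)
Lemma pexpo_sum_cvg y : 0 <= y < 1 ->
  (fun m => \sum_(1 <= k < m.+1) (pexpo k)%:R * y ^+ k) @ \oo --> loglimit y.
Proof.
move=> hy; have /andP[y0 y1] := hy; have y10 : 0 < 1 - y by rewrite subr_gt0.
pose v (k : nat) : R := (pexpo k)%:R * y ^+ k.
have v0 k : 0 <= v k by rewrite mulr_ge0 ?exprn_ge0.
have cv : cvgn (series v).
  apply: nondecreasing_is_cvgn; first by apply: nondecreasing_series => i _ _; exact: v0.
  exists (1 + loglimit y) => _ [m _ <-].
  apply: (@le_trans _ _ (series v m.+1)).
    by rewrite /series /= big_nat_recr //= lerDl.
  rewrite /series /= big_ltn // lerD //; first by rewrite /v expr0 mulr1.
  exact: pexpo_sum_le.
have v_to0 := cvg_series_cvg_0 cv.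
(* The tail after [m] terms is [y^(m+1) / (1 - y)^3] times a sum of three terms,
   each at most [pexpo m]. *)
pose c : R := 3 / (1 - y) ^+ 3.
have low_cvg : (fun m => loglimit y - c * v m) @ \oo --> loglimit y.
  rewrite -[X in _ --> X]subr0 -[X in _ - X](mulr0 c).
  apply: cvgB; first exact: cvg_cst.
  by apply: cvgM; [exact: cvg_cst|].
apply: (squeeze_cvgr _ low_cvg (cvg_cst (loglimit y))).
apply: nearW => m; apply/andP; split; last exact: pexpo_sum_le.
rewrite pexpo_sum ?lt_eqF // -/(loglimit y) lerB // /c [leRHS]mulrAC ler_pM2r ?invr_gt0
  ?exprn_gt0 //.
have e1 : 1 <= (pexpo m)%:R :> R by rewrite ler1n /pexpo addn1.
have em : m%:R <= (pexpo m)%:R :> R by rewrite ler_nat pexpo_ge.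
have h1 : (1 - y) * m%:R <= (pexpo m)%:R.
  by apply: le_trans em; rewrite ler_piMl //; lra.
have h2 : (1 - y) ^+ 2 * (pexpo m)%:R <= (pexpo m)%:R.
  by rewrite ler_piMl // exprn_ile1 //; lra.
rewrite /v mulrA mulrC; apply: ler_pM; [|exact: exprn_ge0|lra|].
  have h3 : 0 <= (1 - y) * m%:R by rewrite mulr_ge0 // ltW.
  have h4 : 0 <= (1 - y) ^+ 2 * (pexpo m)%:R by rewrite mulr_ge0 ?exprn_ge0 // ltW.
  by lra.
by rewrite exprS ler_piMl ?exprn_ge0 // ltW.
Qed.

(** Every [x] in [[0, 1/2]] is covered by the bound at 1/2. *)
Lemma cvg_eulerprod x : 0 <= x <= 2^-1 -> cvgn (eulerprod x).
Proof.
move=> /andP[x0 x1]; have hx : 0 <= x < 1 by apply/andP; split=> //; lra.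
apply: nondecreasing_is_cvgn; first by move=> m m'; apply: eulerprod_nondecreasing.
exists (395 + 5 / 10 ^+ 4) => _ [m _ <-].
apply: le_trans (eulerprod_half R m).
by apply: eulerprod_le; [apply/andP|lra].
Qed.

Lemma eulerprod_le_lim x m : 0 <= x <= 2^-1 -> eulerprod x m <= limn (eulerprod x).
Proof.
move=> hx; have hx1 : 0 <= x < 1 by case/andP: hx => x0 x1; apply/andP; split=> //; lra.
apply: nondecreasing_cvgn_le; last exact: cvg_eulerprod.
by move=> i j; apply: eulerprod_nondecreasing.
Qed.

(** Exchanging the two sums, [\sum_d (x^k)^d / d] is a partial sum of the series of
    [- ln (1 - x^k)]. *)
Lemma exp_pexpo_le x n m : 0 <= x < 1 ->
  expR (\sum_(0 <= d < n) (\sum_(1 <= k < m.+1) (pexpo k)%:R * (x ^+ d.+1) ^+ k) / d.+1%:R)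
    <= eulerprod x m.
Proof.
move=> hx; under eq_bigr do rewrite mulr_suml.
rewrite exchange_big /= expR_sum /eulerprod big_nat [leRHS]big_nat.
apply: ler_prod => k /andP[k0 _]; rewrite expR_ge0 /=.
have -> : \sum_(0 <= d < n) (pexpo k)%:R * (x ^+ d.+1) ^+ k / d.+1%:R =
  (pexpo k)%:R * \sum_(0 <= d < n) (x ^+ k) ^+ d.+1 / d.+1%:R.
  rewrite mulr_sumr; apply: eq_bigr => d _.
  by rewrite -!exprM mulnC mulrA.
have hk : 0 <= x ^+ k < 1.
  have /andP[x0 x1] := hx; rewrite exprn_ge0 //= exprn_ilt1 //.
  by rewrite -lt0n.
rewrite expRM_natl -exprVn lerXn2r ?nnegrE ?expR_ge0 ?log_partial_le //.
by rewrite invr_ge0 subr_ge0 ltW //; case/andP: hk.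
Qed.

Lemma exp_loglimit_le x n : 0 <= x <= 2^-1 ->
  expR (\sum_(0 <= d < n) loglimit (x ^+ d.+1) / d.+1%:R) <= limn (eulerprod x).
Proof.
move=> hx; have hx1 : 0 <= x < 1 by case/andP: hx => x0 x1; apply/andP; split=> //; lra.
pose u m : R := expR (\sum_(0 <= d < n)
  (\sum_(1 <= k < m.+1) (pexpo k)%:R * (x ^+ d.+1) ^+ k) / d.+1%:R).
have cu : u @ \oo --> expR (\sum_(0 <= d < n) loglimit (x ^+ d.+1) / d.+1%:R).
  apply: continuous_cvg; first exact: continuous_expR.
  elim: (n) => [|k IH].
    under eq_fun do rewrite big_geq //.
    by rewrite big_geq //; exact: cvg_cst.
  under eq_fun do rewrite big_nat_recr //=.
  rewrite big_nat_recr //=; apply: cvgD => //.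
  apply: cvgM; last exact: cvg_cst.
  apply: pexpo_sum_cvg; have /andP[x0 x1] := hx1.
  by rewrite exprn_ge0 //= exprn_ilt1.
rewrite -(cvg_lim (@Rhausdorff R) cu); apply: limr_le; first by apply/cvg_ex; eexists; exact: cu.
apply: nearW => m; apply: le_trans (exp_pexpo_le n m hx1) _.
exact: eulerprod_le_lim.
Qed.

End UpperBound.

(** * The upper bound *)

Section DensityBound.
Variables (R : realType) (F : finFieldType).
Local Notation q := #|F|.
Local Notation x := (q%:R^-1 : R).

(** With [Q = q^d], this is [Q^k / block_weight d k], minus [1 / d] in the case [k =
    1]. *)
Definition block_excess (d k : nat) : R :=
  (if k == 1%N then x ^+ d / (1 - x ^+ d) else x ^+ (d * k.-1) / (1 - x ^+ d) ^+ 2) / d%:R.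

Lemma invq_itv : 0 <= x <= 2^-1.
Proof.
rewrite invr_ge0 ler0n /= lef_pV2 ?posrE ?ltr0n ?(ltnW (finNzRing_gt1 F)) //.
by rewrite ler_nat finNzRing_gt1.
Qed.

Lemma block_excess_ge0 d k : (0 < d)%N -> 0 <= block_excess d k.
Proof.
move=> d0; have /andP[x0 x2] := invq_itv.
have hx : 0 <= x < 1 by rewrite x0 /=; lra.
have /andP[h1 _] := one_sub_expr_itv hx d0; have h2 := ltW h1.
by rewrite /block_excess; case: ifP => _; rewrite !divr_ge0 ?exprn_ge0.
Qed.

Lemma block_weight_ratio d k : (0 < d)%N -> (0 < k)%N ->
  (q ^ (d * k))%:R / (block_weight F d k)%:R = (k == 1%N)%:R / d%:R + block_excess d k :> R.
Proof.
move=> d0 k0; have q1 := finNzRing_gt1 F.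
have Q1 : (1 < q ^ d)%N by rewrite -(exp1n d) ltn_exp2r.
have dR : d%:R != 0 :> R by rewrite pnatr_eq0 -lt0n.
pose Q : R := (q ^ d)%:R.
have xQ : x ^+ d = Q^-1 by rewrite exprVn /Q natrX.
have Q10 : Q - 1 != 0 by rewrite subr_eq0 pnatr_eq1 gtn_eqF.
have Q0 : Q != 0 by rewrite pnatr_eq0 -lt0n ltnW.
have QX j : (q ^ (d * j))%:R = Q ^+ j :> R by rewrite expnM natrX.
have Q1E : (q ^ d - 1)%:R = Q - 1 by rewrite natrB // ltnW.
have xk j : x ^+ (d * j) = Q ^- j by rewrite exprM xQ exprVn.
rewrite /block_weight /block_excess xQ; case: k k0 => // -[_|k _].
  rewrite eqxx /= muln0 expn0 !muln1 natrM Q1E -/Q; field.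
  by rewrite dR Q0 Q10.
rewrite !natrM !QX Q1E /= xk; have Qk j : Q ^+ j != 0 by rewrite expf_neq0.
rewrite mul0r add0r !exprS.
have := Qk k; move: (Q ^+ k) => T T0; field.
by rewrite dR Q0 Q10 T0.
Qed.

Lemma ncmax0 : (ncmax F 0 <= 1)%N.
Proof.
apply/bigmax_leqP => X _; apply: leq_trans (max_card _) _.
by rewrite card_mx mul0n expn0.
Qed.

(** The terms [1 / d] of the blocks with [k = 1] account for the factor [(1 - v)^-1]
    of the generating function. *)
Lemma sum_linear_blocks (b : nat -> R) m n : (m < n)%N ->
  \sum_(0 <= i < m.+1) b i = \sum_(t <- block_types n | (t.1 * t.2 <= m.+1)%N)
     (t.1 * t.2)%:R * ((t.2 == 1%N)%:R / t.1%:R) * b (m.+1 - t.1 * t.2)%N.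
Proof.
move=> mn; rewrite [RHS](bigID (fun t => t.2 == 1%N)) /= [X in _ + X]big1 ?addr0; last first.
  by move=> t /andP[_ /negPf->]; rewrite mul0r mulr0 mul0r.
rewrite -[RHS]big_filter [RHS](perm_big [seq (d, 1%N) | d <- iota 1 m.+1]); last first.
  apply: uniq_perm.
  - exact/filter_uniq/block_types_uniq.
  - by rewrite map_inj_uniq ?iota_uniq // => a b' [->].
  move=> [d k]; rewrite mem_filter mem_block_types.
  apply/idP/mapP => [/andP[/andP[le /eqP ke] /and3P[d0 _ _]]|[d' + [-> ->]]].
    rewrite /= in le ke.
    by exists d; [rewrite mem_iota d0 add1n ltnS; rewrite ke muln1 in le|rewrite ke].
  rewrite mem_iota add1n ltnS /= muln1 eqxx andbT /= => /andP[-> le].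
  by rewrite le /= (leq_trans le).
rewrite big_map big_nat_rev -[iota 1 m.+1]/(index_iota 1 m.+2) big_add1.
apply: eq_big_nat => i _; cbn [fst snd].
by rewrite add0n muln1 eqxx mul1r divff ?mul1r ?pnatr_eq0.
Qed.

(** The numbers [q^n ncdens n] satisfy, as an inequality, the recursion of the
    coefficients of [(1 - v)^-1 exp (\sum (block_excess d k) v^(d k))]. *)
Lemma ncdens_le_expcoef n :
  q%:R ^+ n * ncdens R F n <=
  expcoef [seq ((t.1 * t.2)%N, block_excess t.1 t.2) | t <- block_types n] n.
Proof.
have tP t : t \in block_types n -> [/\ 0 < t.1, 0 < t.2 & t.1 * t.2 <= n]%N.
  by case: t => d k; rewrite mem_block_types => /and3P[].
have q0 : 0 < q%:R :> R by rewrite ltr0n ltnW ?finNzRing_gt1.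
apply: (@expcoef_pointwise R _ n (fun m => q%:R ^+ m * ncdens R F m)).
- by move=> _ /mapP[t /tP[h1 h2 _] ->] /=; rewrite muln_gt0 h1.
- by move=> _ /mapP[t /tP[h1 h2 _] ->] /=; apply: block_excess_ge0.
- rewrite expr0 mul1r /ncdens ler_pdivrMr ?ltr0n ?unit_mxs_gt0 // mul1r ler_nat.
  exact: leq_trans ncmax0 (unit_mxs_gt0 F 0).
move=> [//|m] /andP[_ mn]; cbv beta; rewrite [leLHS]mulrCA.
apply: le_trans (ler_wpM2l (exprn_ge0 m.+1 (ltW q0)) (ncdens_recursion R F mn)) _.
rewrite mulr_sumr big_map.
rewrite [X in _ <= _ + X](_ : _ = \sum_(t <- block_types n | (t.1 * t.2 <= m.+1)%N)
   (t.1 * t.2)%:R * block_excess t.1 t.2 * (q%:R ^+ (m.+1 - t.1 * t.2) * ncdens R F (m.+1 - t.1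
     * t.2))) //.
have -> : \sum_(0 <= i < m.+1) q%:R ^+ i * ncdens R F i =
   \sum_(t <- block_types n | (t.1 * t.2 <= m.+1)%N)
     (t.1 * t.2)%:R * ((t.2 == 1%N)%:R / t.1%:R) *
       (q%:R ^+ (m.+1 - t.1 * t.2) * ncdens R F (m.+1 - t.1 * t.2)).
  exact: (sum_linear_blocks (fun i => q%:R ^+ i * ncdens R F i) mn).
rewrite -big_split big_seq_cond [leRHS]big_seq_cond /=; apply: ler_sum => t /andP[/tP[d0 k0 _] le].
rewrite -mulrDl -mulrDr -block_weight_ratio //.
rewrite -{1}(subnK le) exprD natrX.
by rewrite le_eqVlt; apply/orP; left; apply/eqP; ring.
Qed.

(** For [y = x^d], the sum over all [k] of [d * block_excess d k] is [y / (1 - y) +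
    (y + y^2 + ...) / (1 - y)^2], which is [loglimit y]. *)
Lemma sum_block_excess n :
  \sum_(t <- block_types n) block_excess t.1 t.2 <=
  \sum_(0 <= d < n) loglimit (x ^+ d.+1) / d.+1%:R.
Proof.
have /andP[x0 x2] := invq_itv.
have hx : 0 <= x < 1 by rewrite x0 /=; lra.
rewrite /block_types big_filter.
apply: (@le_trans _ _ (\sum_(t <- [seq (d, k) | d <- iota 1 n, k <- iota 1 n]) block_excess t.1
  t.2)).
  rewrite big_mkcond big_seq [leRHS]big_seq; apply: ler_sum => t.
  move=> /allpairsP[[d k] [+ _ ->]]; rewrite mem_iota => /andP[d0 _].
  by case: ifP => //= _; apply: block_excess_ge0.
have -> : iota 1 n = index_iota 1 n.+1 by rewrite /index_iota subSS subn0.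
rewrite big_allpairs /= big_add1 /=; apply: ler_sum => d _.
pose y := x ^+ d.+1; have /andP[y10 _] := one_sub_expr_itv hx (ltn0Sn d).
have y0 : 0 <= y by rewrite exprn_ge0.
rewrite -/y in y10; have h : 1 - y != 0 by rewrite gt_eqF.
have geom k : \sum_(1 <= j < k.+1) y ^+ j.-1 / (1 - y) ^+ 2 * (j != 1%N)%:R
    <= y / (1 - y) ^+ 3.
  have -> : \sum_(1 <= j < k.+1) y ^+ j.-1 / (1 - y) ^+ 2 * (j != 1%N)%:R =
     if k is k'.+1 then y * (1 - y ^+ k') / (1 - y) ^+ 3 else 0.
    case: k => [|k]; first by rewrite big_geq.
    rewrite big_ltn // mulr0 add0r; elim: k => [|k IH].
      by rewrite big_geq // expr0 subrr mulr0 mul0r.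
    by rewrite big_nat_recr //= IH mulr1 !exprS; move: (y ^+ k) => z; field.
  case: k => [|k]; first by rewrite divr_ge0 ?exprn_ge0 // ltW.
  rewrite ler_pM2r ?invr_gt0 ?exprn_gt0 // ler_piMr // lerBlDr lerDl.
  exact: exprn_ge0.
have ones k : \sum_(1 <= j < k.+1) y / (1 - y) * (j == 1%N)%:R <= y / (1 - y).
  case: k => [|k]; first by rewrite big_geq // divr_ge0 // ltW.
  rewrite big_ltn // eqxx mulr1 big_nat big1 ?addr0 // => j /andP[j1 _].
  by rewrite gtn_eqF // mulr0.
rewrite /loglimit -/y.
rewrite (eq_bigr (fun j => (y / (1 - y) * (j == 1%N)%:R + y ^+ j.-1 / (1 - y) ^+ 2 * (j !=
  1%N)%:R) / d.+1%:R)).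
  rewrite -mulr_suml ler_pM2r ?invr_gt0 ?ltr0n // big_split /=.
  exact: lerD.
move=> j _; rewrite /block_excess -/y; case: eqP => [->|_] /=.
  by rewrite mulr1 mulr0 addr0.
by rewrite mulr0 add0r mulr1 exprM.
Qed.

Lemma ncdens_upper n : q%:R ^+ n * ncdens R F n <= limn (eulerprod x).
Proof.
apply: le_trans (ncdens_le_expcoef n) _.
have L0 t : t \in [seq ((t.1 * t.2)%N, block_excess t.1 t.2) | t <- block_types n] -> 0 <= t.2.
  move=> /mapP[[d k] + ->]; rewrite mem_block_types => /and3P[d0 _ _].
  exact: block_excess_ge0.
apply: le_trans (expcoef_le_expR n L0) _.
apply: le_trans _ (exp_loglimit_le n invq_itv).
by rewrite ler_expR big_map sum_block_excess.
Qed.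
End DensityBound.

(** * Companion matrices of polynomials with nonzero constant term *)

Section LowerBound.
Variables (F : finFieldType) (N : nat).
Local Notation q := #|F|.
Local Notation n := N.+1.

(** The monic polynomial of degree [n] with lower coefficients [u]. *)
Definition monpoly (u : 'rV[F]_n) : {poly F} := 'X^n + rVpoly u.
(** The companion matrix of [monpoly u]. *)
Definition compoly (u : 'rV[F]_n) : 'M[F]_n := compmx n (monpoly u).
(** The centralizer of [x] in the group of invertible matrices. *)
Definition unit_cent (x : 'M[F]_n) : {set 'M[F]_n} := [set z | (z \in unitmx) && (z *m x == x *m
  z)].

Lemma size_monpoly u : size (monpoly u) = n.+1.
Proof. by rewrite size_addl size_polyXn // ltnS size_poly. Qed.

Lemma monpoly_monic u : monpoly u \is monic.
Proof. by rewrite monicE lead_coefDl ?lead_coefXn // size_polyXn ltnS size_poly. Qed.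

Lemma monpoly_inj u v : monpoly u %| monpoly v -> u = v.
Proof.
move=> uv; apply: (can_inj (@rVpolyK F n)); apply: (addrI 'X^n).
apply/eqP; rewrite -eqp_monic ?monpoly_monic // -dvdp_size_eqp //.
by rewrite !size_monpoly.
Qed.

(** Companion matrices of different polynomials are not conjugate: they have
    different minimal polynomials. *)
Lemma conj_compoly_inj u v (g h : 'M[F]_n) : g \in unitmx -> h \in unitmx ->
  invmx g *m compoly u *m g = invmx h *m compoly v *m h -> u = v.
Proof.
move=> gu hu e; apply/monpoly_inj;
  rewrite -(horner_compmx_eq0 (N := N)) ?monpoly_monic ?size_monpoly //.
have e' : (h *m invmx g) *m compoly u = compoly v *m (h *m invmx g).
  have := congr1 (fun y => h *m y *m invmx g) e.
  by rewrite !mulmxA mulmxK // mulmxV // mul1mx.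
have := horner_mx_intertwine (monpoly v) e'.
rewrite compmx_root ?monpoly_monic ?size_monpoly // mul0mx => /(congr1 (mulmx (g *m invmx h))).
by rewrite mulmx0 !mulmxA mulmxKV // mulmxV // mul1mx => /eqP.
Qed.

(** By the Cayley-Hamilton identity, [x g(x) = - u_0] for the companion matrix [x]
    and a polynomial [g]. *)
Lemma compoly_unit (u : 'rV[F]_n) : u 0 0 != 0 -> compoly u \in unitmx.
Proof.
move=> u0.
have C0 : horner_mx (compoly u) (monpoly u) = 0.
  exact: compmx_root (monpoly_monic u) (size_monpoly u).
have : root (monpoly u - (u 0 0)%:P) 0.
  by rewrite rootE !hornerE expr0n add0r horner_coef0 (coef_rVpoly_ord u 0) subrr.
move=> /factor_theorem[g]; rewrite subr0 => /(canRL (subrK _)) e.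
move: C0; rewrite e rmorphD /= horner_mxM horner_mx_X horner_mx_C => /eqP.
rewrite addr_eq0 => /eqP h.
have : (- (u 0 0)^-1) *: horner_mx (compoly u) g *m compoly u = 1%:M.
  by rewrite -scalemxAl h scalerN scaleNr opprK scale_scalar_mx mulVf.
by move=> /mulmx1_unit[].
Qed.

(** An invertible element [h(C)] of the centralizer has [h] prime to [monpoly u], so
    that [h] does not vanish at the roots of [monpoly u]. *)
Lemma root_monpoly_unit_cent u a z : root (monpoly u) a -> z \in unit_cent (compoly u) ->
  (rVpoly (delta_mx 0 0 *m z)).[a] != 0.
Proof.
rewrite inE => /factor_theorem[g e] /andP[zu /eqP zc].
have zE : z = _ := comm_compmx zc; set h := rVpoly _ in zE *.
have g0 : g != 0.
  by apply: contraTneq (monpoly_monic u) => g0;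
    rewrite e g0 mul0r monicE lead_coef0 eq_sym oner_eq0.
have sg : (size g <= n)%N.
  have := size_monpoly u; rewrite e size_Mmonic ?monicXsubC // size_XsubC addn2.
  by case=> ->.
apply/negP => ha; have /factor_theorem[k ke] : root h a by [].
pose w := delta_mx 0 0 *m horner_mx (compoly u) g : 'rV[F]_n.
have wz : w *m z = 0.
  rewrite /w zE -mulmxA -horner_mxM ke mulrCA -e horner_mxM compmx_root ?mulmx0 //.
    exact: monpoly_monic.
  exact: size_monpoly.
have w0 : w = 0 by rewrite -[w](mulmxK zu) wz mul0mx.
case/eqP: g0; rewrite -(poly_rV_K sg) -[poly_rV g](delta_horner_compmx (monpoly u)).
by rewrite poly_rV_K // -/(compoly u) -/w w0 linear0.
Qed.

(** The roots of [monpoly u] in the ground field. *)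
Definition rootset u : {set F} := [set a | root (monpoly u) a].

Lemma card_rootset_le u : (#|rootset u| <= n)%N.
Proof.
have := @max_poly_roots F (monpoly u) (enum (rootset u)).
rewrite -size_poly_eq0 size_monpoly ltnS -cardE; apply=> //; last exact: enum_uniq.
by apply/allP => a; rewrite mem_enum inE.
Qed.

(** An element [h(C)] of the centralizer, with [h] of degree less than [n], is
    determined by the values of [h] at the [r] roots and by its coefficients of
    degree at least [r]. The values are nonzero. *)
Lemma card_unit_cent_compoly u :
  (#|unit_cent (compoly u)| <= (q - 1) ^ #|rootset u| * q ^ (n - #|rootset u|))%N.
Proof.
set S := rootset u; set r := #|S|; have rn : (r <= n)%N := card_rootset_le u.
pose h (z : 'M[F]_n) := rVpoly (delta_mx 0 0 *m z : 'rV[F]_n).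
pose phi (z : 'M[F]_n) : {ffun F -> F} * 'rV[F]_(n - r) :=
  ([ffun a => if a \in S then (h z).[a] else 1], \row_i (h z)`_(r + i)).
have phi_inj : {in unit_cent (compoly u) &, injective phi}.
  move=> z z'; rewrite !inE => /andP[_ /eqP zc] /andP[_ /eqP z'c] [/ffunP e1 /rowP e2].
  rewrite (comm_compmx zc) (comm_compmx z'c) -/(h z) -/(h z'); congr horner_mx.
  apply/eqP; rewrite -subr_eq0; apply/eqP.
  apply: (@roots_geq_poly_eq0 _ _ (enum S)).
  - apply/allP => a; rewrite mem_enum => aS; have := e1 a; rewrite !ffunE aS => e.
    by rewrite rootE !hornerE e subrr.
  - exact: enum_uniq.
  rewrite -cardE -/r; apply/leq_sizeP => j rj; rewrite coefB.
  have [nj|jn] := leqP n j.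
    by rewrite !nth_default ?subrr // (leq_trans (size_poly _ _)).
  have lt : (j - r < n - r)%N by rewrite ltn_sub2r // (leq_ltn_trans rj).
  by have := e2 (Ordinal lt); rewrite !mxE /= subnKC // => ->; rewrite subrr.
rewrite -(card_in_imset phi_inj).
apply: (@leq_trans #|finset.setX [set f in pffun_on 1 S (predC1 0)] [set: 'rV[F]_(n - r)]|).
  apply: subset_leq_card; apply/fintype.subsetP => _ /imsetP[z zc ->].
  rewrite !inE andbT; apply/pffun_onP; split.
    apply/fintype.subsetP => a; rewrite inE ffunE; case: ifP => //; by rewrite eqxx.
  move=> _ /fintype.imageP[a aS ->]; rewrite ffunE aS inE /=.
  apply: root_monpoly_unit_cent zc; by rewrite inE in aS.
rewrite cardsX cardsT card_mx mul1n cardsE card_pffun_on -/r.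
by rewrite cardC1 subn1.
Qed.

End LowerBound.

(** * A maximal non-commuting set of conjugates of companion matrices *)

Section LowerBoundCount.
Variables (R : realFieldType) (F : finFieldType) (N : nat).
Local Notation q := #|F|.
Local Notation n := N.+1.
Local Notation U := ([set u : 'rV[F]_n | u 0 0 != 0]).

(** The conjugate by [g] of the companion matrix, for [t = (u, g)]. *)
Definition conjcomp (t : 'rV[F]_n * 'M[F]_n) : 'M[F]_n := invmx t.2 *m compoly t.1 *m t.2.

Lemma unit_cent_conjcomp_comm u g (z z' : 'M[F]_n) : g \in unitmx ->
  z \in unit_cent (conjcomp (u, g)) -> z' \in unit_cent (conjcomp (u, g)) -> z *m z' = z' *m z.
Proof.
move=> gu; have conj z0 : z0 \in unit_cent (conjcomp (u, g)) ->
    (g *m z0 *m invmx g) *m compoly u = compoly u *m (g *m z0 *m invmx g).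
  rewrite inE => /andP[_ /eqP e].
  have := congr1 (fun y => g *m y *m invmx g) e; rewrite /conjcomp /= !mulmxA.
  by rewrite mulmxK // mulmxV // mul1mx.
move=> /conj zc /conj z'c; have := comm_compmx2 zc z'c.
rewrite !mulmxA !mulmxKV // => /(congr1 (fun y => invmx g *m y *m g)).
by rewrite !mulmxA !mulmxKV // mulVmx // !mul1mx.
Qed.

Lemma card_unit_cent_conjcomp u g : g \in unitmx ->
  (#|unit_cent (conjcomp (u, g))| <= #|unit_cent (compoly u)|)%N.
Proof.
move=> gu; pose h (z : 'M[F]_n) := g *m z *m invmx g.
have hi : injective h.
  move=> z z' /(congr1 (fun y => invmx g *m y *m g)).
  by rewrite /h !mulmxA !mulmxKV // mulVmx // !mul1mx.
rewrite -(card_imset _ hi); apply: subset_leq_card; apply/fintype.subsetP => _ /imsetP[z + ->].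
rewrite !inE => /andP[zu /eqP e]; rewrite !unitmx_mul unitmx_inv gu zu /=.
have := congr1 (fun y => g *m y *m invmx g) e; rewrite /conjcomp /h /= !mulmxA.
by rewrite mulmxK // mulmxV // mul1mx => ->.
Qed.

(** The weight [1 / c^2], with [c] the order of the centralizer of [compoly u]. Each
    conjugate of [compoly u] is [conjcomp (u, g)] for exactly [c] invertible [g];
    its total weight is then [1 / c], the inverse of the order of its centralizer. *)
Definition conj_weight (u : 'rV[F]_n) : R := (#|unit_cent (compoly u)|%:R ^+ 2)^-1.

Lemma unit_cent_gt0 (x : 'M[F]_n) : (0 < #|unit_cent x|)%N.
Proof. by apply/card_gt0P; exists 1%:M; rewrite inE unitmx1 mul1mx mulmx1 eqxx. Qed.

Lemma conj_weight_ge0 (u : 'rV[F]_n) : 0 <= conj_weight u.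
Proof. by rewrite invr_ge0 exprn_ge0. Qed.

(** The conjugate [y] arises from at most [c] pairs [(u, g)], each of weight [1 /
    c^2]. *)
Lemma sum_conj_weight_fiber (x y : 'M[F]_n) (D : {set 'rV[F]_n * 'M[F]_n}) :
    (forall t, t \in D -> t.2 \in unitmx) ->
    (forall t, t \in D -> conjcomp t = y -> #|unit_cent x| = #|unit_cent y|) ->
  \sum_(t in D | conjcomp t == y) conj_weight t.1 <= #|unit_cent x|%:R^-1.
Proof.
move=> Du Dxy.
(* All pairs in the fiber have the same [u], and their second components differ by
   elements of the centralizer. *)
have [t0 /andP[t0D /eqP t0y]|none] := pickP (fun t => (t \in D) && (conjcomp t == y)); last first.
  by rewrite big_pred0 // invr_ge0.
have h t : (t \in D) && (conjcomp t == y) -> t.1 = t0.1 /\ t.2 *m invmx t0.2 \in unit_cent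
  (compoly t0.1).
  case: t t0 t0D t0y => u g [u0 g0] /Du /= g0u <- /andP[/Du /= gu /eqP e].
  have /= uu := conj_compoly_inj gu g0u e; split=> //.
  rewrite inE unitmx_mul gu unitmx_inv g0u /=; apply/eqP.
  have := congr1 (fun y => g *m y *m invmx g0) e; rewrite /conjcomp /= !mulmxA uu.
  by rewrite mulmxK // mulmxV // mul1mx => ->.
rewrite (eq_bigr (fun=> conj_weight t0.1)); last by move=> t /h[->].
rewrite (Dxy t0) //.
rewrite sumr_const -[_ *+ _]mulr_natl.
set c := #|unit_cent (compoly t0.1)|; have c0 : 0 < c%:R :> R by rewrite ltr0n unit_cent_gt0.
apply: (@le_trans _ _ (c%:R * conj_weight t0.1)).
  rewrite ler_wpM2r ?conj_weight_ge0 // ler_nat.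
  have hi : injective (fun t : 'rV[F]_n * 'M[F]_n => (t.1, t.2 *m invmx t0.2)).
    by move=> [u g] [u' g'] [-> /(can_inj (mulmxKV (Du _ t0D)))->].
  have cE : #|finset.setX [set t0.1] (unit_cent (compoly t0.1))| = c by rewrite cardsX cards1 mul1n.
  rewrite -(card_imset _ hi) -[X in (_ <= X)%N]cE.
  apply: subset_leq_card; apply/fintype.subsetP => _ /imsetP[t /h[e1 e2] ->].
  by rewrite !inE /= e1 eqxx; rewrite inE in e2.
rewrite /conj_weight -/c expr2 invfM mulVKf ?gt_eqF // lef_pV2 ?posrE ?ltr0n ?unit_cent_gt0 //.
by have := card_unit_cent_conjcomp t0.1 (Du _ t0D); rewrite -surjective_pairing t0y ler_nat.
Qed.

(** Let [X] be non-commuting of maximal size among the subsets of the union of the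
    conjugacy classes. By maximality, every conjugate commutes with some [x] in [X].
    Since centralizers are commutative, the conjugates [y] that commute with [x]
    have the same centralizer as [x], so their total weight, over all [(u, g)], is
    at most 1 for each [x]. *)
Lemma ncmax_ge_sum_conj_weight : \sum_(u in U) #|unit_mxs F n|%:R * conj_weight u <= (ncmax F n)%:R.
Proof.
pose T := finset.setX U (unit_mxs F n).
have Tu t : t \in T -> t.2 \in unitmx by case: t => u g; rewrite finset.in_setX => /andP[_];
  rewrite inE.
have cT t : t \in T -> conjcomp t \in unitmx.
  move=> tT; have tu := Tu t tT; have cu : compoly t.1 \in unitmx.
    by apply: compoly_unit; case: t tT {tu} => u g; rewrite finset.in_setX inE => /andP[].
  by rewrite !unitmx_mul unitmx_inv tu cu.
pose P (X : {set 'M[F]_n}) := ncset X && (X \subset conjcomp @: T).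
have P0 : (0 < #|[pred X : {set 'M[F]_n} | P X]|)%N.
  apply/card_gt0P; exists finset.set0; rewrite inE; apply/andP; split; last exact: finset.sub0set.
  by apply/ncsetP; split=> [x|x y]; rewrite inE.
have [X /andP[ncX XT] maxX] := eq_bigmax_cond (fun X : {set 'M[F]_n} => #|X|) P0.
have /ncsetP[Xu Xc] := ncX.
(* Otherwise [conjcomp t] could be added to [X]. *)
have cover t : t \in T -> exists2 x, x \in X & x *m conjcomp t == conjcomp t *m x.
  move=> tT; apply: contrapT => no.
  have nocomm x : x \in X -> x *m conjcomp t != conjcomp t *m x.
    by move=> xX; apply/negP => e; apply: no; exists x.
  have tX : conjcomp t \notin X.
    by apply/negP => /nocomm; rewrite eqxx.
  have : (#|conjcomp t |: X| <= #|X|)%N.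
    rewrite -maxX; apply: (@leq_bigmax_cond _ P (fun X : {set 'M[F]_n} => #|X|)).
    apply/andP; split; last by rewrite finset.subUset XT finset.sub1set imset_f.
    apply/ncsetP; split=> [x|x y].
      rewrite !inE => /predU1P[->|/Xu//].
      exact: cT.
    rewrite !inE => /predU1P[->|xX] /predU1P[->|yX] // e.
    - by have := nocomm _ yX; rewrite e eqxx.
    - by have := nocomm _ xX; rewrite e eqxx.
    - exact: Xc.
  by rewrite cardsU1 tX add1n ltnn.
have Tsum : \sum_(t in T) conj_weight t.1 = \sum_(u in U) #|unit_mxs F n|%:R * conj_weight u.
  transitivity (\sum_(u in U) \sum_(g in unit_mxs F n) conj_weight u).
    by rewrite pair_big /=; apply: eq_bigl => -[u g]; rewrite finset.in_setX.
  by apply: eq_bigr => u _; rewrite sumr_const mulr_natl.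
rewrite -Tsum.
apply: (@le_trans _ _ (\sum_(t in T) \sum_(x in X | x *m conjcomp t == conjcomp t *m x)
  conj_weight t.1)).
  apply: ler_sum => t /cover[x xX xc]; rewrite (bigD1 x) ?xX //= lerDl.
  by apply: sumr_ge0 => *; exact: conj_weight_ge0.
rewrite (exchange_big_dep (fun x => x \in X)) /=; last by move=> t x _ /andP[].
apply: (@le_trans _ _ (\sum_(x in X) 1)); last first.
  by rewrite sumr_const ler_nat ncmax_ge.
apply: ler_sum => x xX.
have xT : exists2 t, t \in T & x = conjcomp t by apply/imsetP/(fintype.subsetP XT).
pose D := [set t in T | x *m conjcomp t == conjcomp t *m x].
have -> : \sum_(t in T | (x \in X) && (x *m conjcomp t == conjcomp t *m x)) conj_weight t.1 =
   \sum_(t in D) conj_weight t.1 by apply: eq_bigl => t; rewrite xX /D [RHS]inE.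
have Dcent t : t \in D -> conjcomp t \in unit_cent x.
  rewrite inE => /andP[tT /eqP e]; rewrite inE e eqxx andbT.
  exact: cT.
rewrite (partition_big conjcomp (mem (unit_cent x))) //=.
apply: (@le_trans _ _ (\sum_(y in unit_cent x) #|unit_cent x|%:R^-1)).
  apply: ler_sum => y yc; apply: sum_conj_weight_fiber => [t|t tD ty].
    by rewrite inE => /andP[/Tu].
  have [[u0 g0] /Tu /= g0u x0] := xT; have xu := Xu x xX.
  have tu : t.2 \in unitmx by move: tD; rewrite inE => /andP[/Tu].
  case: t tD ty tu => u g tD <- /= gu.
  have yx := Dcent _ tD; have yx2 := yx; rewrite inE in yx2; have /andP[_ /eqP yx'] := yx2.
  congr #|pred_of_set _|; apply/setP => z; apply/idP/idP => zc; have := zc;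
    rewrite !inE => /andP[-> _] /=.
    apply/eqP; rewrite x0 in zc yx; exact: unit_cent_conjcomp_comm zc yx.
  have xy : x \in unit_cent (conjcomp (u, g)) by rewrite inE xu yx' eqxx.
  by apply/eqP; apply: unit_cent_conjcomp_comm zc xy.
by rewrite sumr_const -[_ *+ _]mulr_natl divff // pnatr_eq0 -lt0n unit_cent_gt0.
Qed.

End LowerBoundCount.

(** * The lower bound *)

Section LowerDensity.
Variables (R : realFieldType) (F : finFieldType) (m : nat).
Local Notation q := #|F|.
Local Notation n := m.+2.
Local Notation U := ([set u : 'rV[F]_n | u 0 0 != 0]).

(** A lower bound for the number of monic polynomials of degree [n] with nonzero
    constant term. *)
Lemma card_nonzero_const : ((q - 1) * q ^ m.+1 <= #|U|)%N.
Proof.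
pose h (t : F * 'rV[F]_m.+1) : 'rV[F]_n := poly_rV (t.1%:P + 'X * rVpoly t.2).
have sz (t : F * 'rV[F]_m.+1) : (size (t.1%:P + 'X * rVpoly t.2)%R <= n)%N.
  rewrite (leq_trans (size_polyD _ _)) // geq_max (leq_trans (size_polyC_leq1 _)) //=.
  by rewrite mulrC (leq_trans (size_polyMleq _ _)) // size_polyX addn2 /= ltnS size_poly.
have hE t : rVpoly (h t) = t.1%:P + 'X * rVpoly t.2 by rewrite poly_rV_K.
have hi : injective h.
  move=> [a u] [b v] /(congr1 (@rVpoly F n)); rewrite !hE /= => e.
  have ab : a = b by have := congr1 (horner^~ 0) e; rewrite !hornerE.
  move: e; rewrite ab => /addrI/mulfI; rewrite polyX_eq0 => /(_ isT)/(can_inj rVpolyK) ->.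
  by [].
have <- : #|finset.setX [set~ (0 : F)] [set: 'rV[F]_m.+1]| = ((q - 1) * q ^ m.+1)%N.
  by rewrite cardsX cardsT cardsC1 card_mx mul1n subn1.
rewrite -(card_imset _ hi); apply: subset_leq_card; apply/fintype.subsetP => _ /imsetP[t + ->].
rewrite !inE andbT => t0; rewrite -[X in X != _](coef_rVpoly_ord (h t) 0) hE.
by rewrite coefD coefC coefXM eqxx addr0.
Qed.

(** A nonzero [a] is a root of at least [(q - 1) q^(n - 2)] of these polynomials. *)
Lemma card_root_nonzero_const (a : F) : a != 0 ->
  ((q - 1) * q ^ m <= #|[set u in U | root (monpoly u) a]|)%N.
Proof.
move=> a0.
(* The linear coefficient is determined by the other coefficients and the condition
   of vanishing at [a]. *)
pose b (t : F * 'rV[F]_m) : F := - (a ^+ n + t.1 + a ^+ 2 * (rVpoly t.2).[a]) / a.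
pose P (t : F * 'rV[F]_m) : {poly F} := t.1%:P + 'X * ((b t)%:P + 'X * rVpoly t.2).
have sz t : (size (P t) <= n)%N.
  rewrite (leq_trans (size_polyD _ _)) // geq_max (leq_trans (size_polyC_leq1 _)) //=.
  rewrite mulrC (leq_trans (size_polyMleq _ _)) // size_polyX addn2 /= ltnS.
  rewrite (leq_trans (size_polyD _ _)) // geq_max (leq_trans (size_polyC_leq1 _)) //=.
  by rewrite mulrC (leq_trans (size_polyMleq _ _)) // size_polyX addn2 /= ltnS size_poly.
pose h t : 'rV[F]_n := poly_rV (P t).
have hE t : rVpoly (h t) = P t by rewrite poly_rV_K.
have X0 : 'X != 0 :> {poly F} by rewrite polyX_eq0.
have hi : injective h.
  move=> t t' /(congr1 (@rVpoly F n)); rewrite !hE /P => e.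
  have e1 : t.1 = t'.1 by have := congr1 (horner^~ 0) e; rewrite !hornerE.
  move: e; rewrite e1 => /addrI/(mulfI X0) e.
  have e2 : b t = b t' by have := congr1 (horner^~ 0) e; rewrite !hornerE.
  move: e; rewrite e2 => /addrI/(mulfI X0)/(can_inj rVpolyK) e3.
  by case: t t' e1 e3 {e2} => [c u] [c' u'] /= -> ->.
have <- : #|finset.setX [set~ (0 : F)] [set: 'rV[F]_m]| = ((q - 1) * q ^ m)%N.
  by rewrite cardsX cardsT cardsC1 card_mx mul1n subn1.
rewrite -(card_imset _ hi); apply: subset_leq_card; apply/fintype.subsetP => _ /imsetP[t + ->].
rewrite !inE andbT => t0; apply/andP; split.
  rewrite -[X in X != _](coef_rVpoly_ord (h t) 0) hE.
  by rewrite coefD coefC coefXM eqxx addr0.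
rewrite /monpoly hE rootE /P !(hornerD, hornerM, hornerX, hornerC, hornerXn) /b; apply/eqP; field.
exact: a0.
Qed.

(** Incidences between polynomials and their roots, counted by the roots. *)
Lemma sum_card_rootset : ((q - 1) * ((q - 1) * q ^ m) <= \sum_(u in U) #|rootset u|)%N.
Proof.
under eq_bigr do rewrite -sum1_card.
rewrite (exchange_big_dep predT) //=.
rewrite (bigID (fun a => a != 0)) /=; apply: leq_trans (leq_addr _ _).
have <- : #|[set~ (0 : F)]| = (q - 1)%N by rewrite cardsC1 subn1.
rewrite -sum_nat_const; apply: (@leq_trans (\sum_(a in [set~ (0 : F)]) #|[set u in U | root
  (monpoly u) a]|)).
  by rewrite cardsC1 -subn1; apply: leq_sum => a; rewrite !inE; exact: card_root_nonzero_const.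
apply: eq_leq; apply: eq_big => a; first by rewrite !inE.
by move=> _; rewrite -sum1_card; apply: eq_bigl => u; rewrite !inE.
Qed.

(** With [r] roots, the centralizer has at most [q^n (1 - 1/q)^r] elements;
    Bernoulli's inequality makes the resulting bound for the weight linear in [r]. *)
Lemma conj_weight_ge (u : 'rV[F]_n) :
  (q%:R ^+ n)^-1 ^+ 2 * (1 + #|rootset u|%:R * ((1 - q%:R^-1) ^- 2 - 1)) <= conj_weight R u.
Proof.
have q1 : (1 < q)%N := finNzRing_gt1 F.
have q0 : 0 < q%:R :> R by rewrite ltr0n ltnW.
have x1 : 0 < 1 - q%:R^-1 :> R by rewrite subr_gt0 invf_lt1 // ltr1n.
have x2 : 1 - q%:R^-1 <= 1 :> R by rewrite gerBl invr_ge0 ltW.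
set r := #|rootset u|; have rn : (r <= n)%N := card_rootset_le u.
have c_le : #|unit_cent (compoly u)|%:R <= q%:R ^+ n * (1 - q%:R^-1) ^+ r :> R.
  have e1 : q%:R ^+ n = q%:R ^+ r * q%:R ^+ (n - r) :> R by rewrite -exprD subnKC.
  have e2 : (q - 1)%:R = q%:R * (1 - q%:R^-1) :> R.
    by rewrite natrB 1?ltnW // mulrBr mulr1 divff // gt_eqF.
  have := card_unit_cent_compoly u; rewrite -/r -(ler_nat R) natrM [(_ ^ r)%:R]natrX.
  by rewrite [(_ ^ (_ - r))%:R]natrX e2 exprMn e1 mulrAC.
have c0 : 0 < #|unit_cent (compoly u)|%:R :> R by rewrite ltr0n unit_cent_gt0.
have h0 : 0 < q%:R ^+ n * (1 - q%:R^-1) ^+ r :> R by rewrite mulr_gt0 ?exprn_gt0.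
apply: (@le_trans _ _ (((q%:R ^+ n * (1 - q%:R^-1) ^+ r) ^+ 2)^-1)); last first.
  rewrite /conj_weight lef_pV2 ?posrE ?exprn_gt0 // lerXn2r ?nnegrE // ltW //.
rewrite [((q%:R ^+ n)^-1) ^+ 2]exprVn [X in _ <= X^-1]exprMn [X in _ <= X]invfM.
apply: ler_wpM2l; first by rewrite invr_ge0 !exprn_ge0 // ltW.
have -> : (((1 - q%:R^-1) ^+ r) ^+ 2)^-1 = (1 + ((1 - q%:R^-1) ^- 2 - 1)) ^+ r :> R.
  by rewrite [1 + (_ - 1)]addrC subrK exprAC [RHS]exprVn.
apply: bernoulli_le; apply: (@le_trans _ _ 0); first by rewrite lerN10.
by rewrite subr_ge0 invf_ge1 ?exprn_gt0 // exprn_ile1 // ltW.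
Qed.

Lemma ncdens_lower : (q%:R ^+ n)^-1 <= ncdens R F n.
Proof.
have q1 : (1 < q)%N := finNzRing_gt1 F.
have q0 : 0 < q%:R :> R by rewrite ltr0n ltnW.
have x1 : 0 < 1 - q%:R^-1 :> R by rewrite subr_gt0 invf_lt1 // ltr1n.
rewrite /ncdens ler_pdivlMr ?ltr0n ?unit_mxs_gt0 //.
apply: le_trans (ncmax_ge_sum_conj_weight R F m.+1); rewrite mulrC -mulr_sumr ler_wpM2l //.
apply: le_trans (ler_sum _ (fun u _ => conj_weight_ge u)).
rewrite -mulr_sumr big_split /= sumr_const -mulr_suml.
have x2 : 1 - q%:R^-1 <= 1 :> R by rewrite gerBl invr_ge0 ltW.
set d := (_ ^- 2 - 1); have d0 : 0 <= d.
  by rewrite subr_ge0 invf_ge1 ?exprn_gt0 // exprn_ile1 // ltW.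
have h1 : ((q - 1) * q ^ m.+1)%:R <= #|U|%:R :> R by rewrite ler_nat card_nonzero_const.
have h2 : ((q - 1) * ((q - 1) * q ^ m))%:R <= \sum_(u in U) #|rootset u|%:R :> R.
  by rewrite -natr_sum ler_nat sum_card_rootset.
apply: (@le_trans _ _ ((q%:R ^+ n)^-1 ^+ 2 * (((q - 1) * q ^ m.+1)%:R + ((q - 1) * ((q - 1) * q
  ^ m))%:R * d))).
  have qB : (q - 1)%:R = q%:R - 1 :> R by rewrite natrB // ltnW.
  have E1 j : ((q - 1) * q ^ j)%:R = (q%:R - 1) * q%:R ^+ j :> R.
    by rewrite natrM qB natrX.
  have E2 : ((q - 1) * ((q - 1) * q ^ m))%:R = (q%:R - 1) * ((q%:R - 1) * q%:R ^+ m) :> R.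
    by rewrite natrM E1 qB.
  rewrite E1 E2 /d {E1 E2}.
  have := exprn_gt0 m q0; have q10 : q%:R - 1 != 0 :> R by rewrite subr_eq0 pnatr_eq1 gtn_eqF.
  have q00 : q%:R != 0 :> R by rewrite gt_eqF.
  rewrite -subr_ge0 !exprS expr0; move: (q%:R ^+ m) => T T0.
  have TN : T != 0 by rewrite gt_eqF.
  (* After inserting the two counts, the surplus over [q^-n] is [(q - 1) / (q^4 T)]
     with [T = q^(n - 2)]. *)
  rewrite [X in 0 <= X](_ : _ = (q%:R - 1) / (q%:R ^+ 4 * T)); last first.
    by field; rewrite ?q00 ?q10 ?TN.
  by rewrite divr_ge0 ?mulr_ge0 ?exprn_ge0 ?(ltW T0) // subr_ge0 ler1n ltnW.
apply: ler_wpM2l; first by rewrite exprn_ge0 // invr_ge0 exprn_ge0 // ltW.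
by apply: lerD => //; apply: ler_wpM2r.
Qed.
End LowerDensity.

(** * General linear groups *)

Lemma omega_ge (gT : finGroupType) (G : {group gT}) (X : {set gT}) :
  X \subset G -> noncommuting X -> (#|X| <= omega G)%N.
Proof.
move=> XG Xc; have h : (X \subset G) && noncommuting X by rewrite XG.
exact: (@leq_bigmax_cond _ (fun X : {set gT} => (X \subset G) && noncommuting X)
  (fun X : {set gT} => #|X|) X h).
Qed.

Section GeneralLinear.
Variables (F : finFieldType) (m : nat).
Local Notation GL := {'GL_m.+1[F]}.

Lemma GLval_onto (x : 'M[F]_m.+1) : x \in unitmx -> exists g : GL, GLval g = x.
Proof. by move=> xu; exists (FinRing.Unit xu). Qed.

Lemma GLval_inj : injective (@GLval m.+1 F).
Proof. exact: val_inj. Qed.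

Lemma card_GL_unit_mxs : #|'GL_m.+1[F]%G| = #|unit_mxs F m.+1|.
Proof.
rewrite -(card_imset _ GLval_inj); apply: eq_card => x; rewrite inE.
apply/imsetP/idP => [[g _ ->]|/GLval_onto[g <-]]; first exact: (@GL_unitmx m.+1 F g).
by exists g; rewrite ?inE.
Qed.

Lemma noncommutingP (gT : finGroupType) (X : {set gT}) :
  reflect (forall x y, x \in X -> y \in X -> (x * y = y * x)%g -> x = y) (noncommuting X).
Proof.
apply: (iffP forall_inP) => [H x y xX yX e | H x xX].
  apply/eqP/negPn/negP => ne.
  by have /forall_inP/(_ y yX)/implyP/(_ ne)/eqP := H x xX.
apply/forall_inP => y yX; apply/implyP; apply: contra => /eqP e.
by apply/eqP/H.
Qed.

(** The definitions of non-commuting subsets in terms of the group [GL] and in terms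
    of matrices agree. *)
Lemma omega_GL : omega 'GL_m.+1[F]%G = ncmax F m.+1.
Proof.
apply/eqP; rewrite eqn_leq; apply/andP; split; apply/bigmax_leqP => X.
  move=> /andP[_ /noncommutingP Xc]; rewrite -(card_imset _ GLval_inj).
  apply: ncmax_ge.
  apply/ncsetP; split=> [_ /imsetP[g _ ->]|_ _ /imsetP[g gX ->] /imsetP[h hX ->] e].
    exact: (@GL_unitmx m.+1 F g).
  by rewrite (Xc g h) //; apply: GLval_inj; rewrite !GL_MxE.
move=> /ncsetP[Xu Xc]; pose Y := [set g : GL | GLval g \in X].
have XY : X = @GLval m.+1 F @: Y.
  apply/setP => x; apply/idP/imsetP => [xX|[g + ->]]; last by rewrite inE.
  by have [g gx] := GLval_onto (Xu x xX); exists g; rewrite ?inE gx.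
have Ync : (Y \subset 'GL_m.+1[F]%G) && noncommuting Y.
  apply/andP; split; first by apply/fintype.subsetP => g _; rewrite inE.
  apply/noncommutingP => g h; rewrite !inE => gX hX e; apply: GLval_inj; apply: Xc => //.
  exact: (congr1 (@GLval m.+1 F) e).
have -> : #|X| = #|Y| by rewrite XY (card_imset _ GLval_inj).
by have /andP[YG Yc] := Ync; exact: (omega_ge YG Yc).
Qed.

End GeneralLinear.

Lemma l_partial_eulerprod (R : realType) q : l_partial R q = eulerprod (q%:R^-1 : R).
Proof.
by apply/funext => m; apply: eq_bigr => k _; rewrite exprVn.
Qed.

(** The lower bound in positive dimension; dimension 1, where a single matrix is
    enough, is separate. *)
Lemma ncdens_lower_pos (R : realType) (F : finFieldType) m :
  (#|F|%:R ^+ m.+1)^-1 <= ncdens R F m.+1.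
Proof.
case: m => [|m]; last exact: ncdens_lower.
have q0 : 0 < #|F|%:R :> R by rewrite ltr0n ltnW // finNzRing_gt1.
rewrite expr1 /ncdens ler_pdivlMr ?ltr0n ?unit_mxs_gt0 //.
apply: (@le_trans _ _ 1).
  rewrite mulrC ler_pdivrMr // mul1r ler_nat; apply: leq_trans (max_card _) _.
  by rewrite card_mx.
rewrite ler1n; apply: (@leq_trans #|[set (1%:M : 'M[F]_1)]|); first by rewrite cards1.
apply: ncmax_ge.
apply/ncsetP; split=> [x|x y]; rewrite !inE; first by move=> /eqP->; exact: unitmx1.
by move=> /eqP-> /eqP->.
Qed.

Theorem theorem1p2 (R : realType) (q n : nat) (hq : prime_power q)
    (hn : (1 <= n)%N) :
  [/\ cvgn (l_partial R q),
      forall F : finFieldType, #|F| = q ->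
        let r : R := (omega 'GL_n[F]%G)%:R / #|'GL_n[F]%G|%:R in
        q%:R ^- n * (1 - q%:R ^- 3 - q%:R ^- 5 + q%:R ^- 6 - q%:R ^- n) <= r
        /\ r <= q%:R ^- n * l R q,
      (3 <= q)%N ->
        l R q <= 1 + 2 * q%:R ^- 1 + 7 * q%:R ^- 2 + 114 * q%:R ^- 3
    & q = 2%N -> l R q <= 395 + 5 / 10 ^+ 4].
Proof.
have q2 : (2 <= q)%N.
  case: hq => p [k [pp k0 ->]]; rewrite -(prednK k0) expnS.
  by rewrite (leq_trans (prime_gt1 pp)) // leq_pmulr // expn_gt0 prime_gt0.
have q0 : 0 < q%:R :> R by rewrite ltr0n ltnW.
have hx : 0 <= (q%:R^-1 : R) <= 2^-1.
  by rewrite invr_ge0 ltW //= lef_pV2 ?posrE // ler_nat.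
have lE : l R q = limn (eulerprod (q%:R^-1 : R)) by rewrite /l l_partial_eulerprod.
have cvg_l := cvg_eulerprod hx.
split.
- by rewrite l_partial_eulerprod.
- move=> F Fq /=; subst q; case: n hn => // n _.
  rewrite omega_GL card_GL_unit_mxs -/(ncdens R F n.+1) lE; split; last first.
    by rewrite mulrC ler_pdivlMr ?exprn_gt0 // mulrC ncdens_upper.
  (* The density is at least [q^-n], and the factor in parentheses is at most 1. *)
  apply: le_trans (ncdens_lower_pos R F n); rewrite -[leRHS]mulr1.
  apply: ler_wpM2l; first by rewrite invr_ge0 exprn_ge0 // ltW.
  rewrite -!exprVn; set x := _^-1 in hx *.
  have /andP[x0 x2] := hx; have x1 : x <= 1 by lra.
  have h3 : x ^+ 6 <= x ^+ 3 by rewrite -[X in _ <= X]mulr1 (exprD x 3 3) ler_wpM2l ?exprn_ge0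
    // exprn_ile1.
  have h5 : 0 <= x ^+ 5 by rewrite exprn_ge0.
  have hn' : 0 <= x ^+ n.+1 by rewrite exprn_ge0.
  by lra.
- move=> q3; rewrite lE; apply: limr_le => //; apply: nearW => m.
  rewrite -!exprVn expr1; apply: eulerprod_taylor.
  by rewrite invr_gt0 q0 lef_pV2 ?posrE // ler_nat.
move=> qE; rewrite lE; apply: limr_le => //; apply: nearW => m.
by rewrite qE; exact: eulerprod_half.
Qed.
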